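(* Let $\Bbbk$ be a field of characteristic $0$. For integers $t,m,n$ with $m\le n$, $1<t<m$ and $n>t+1$, let $d(t,m,n)$ denote the highest degree of a minimal generator of the ideal $J_t(m,n)$ of relations between the $t$-minors of a generic $m\times n$ matrix over $\Bbbk$. Then $$d(t,m,n)\le d(t,m,m+t).$$
   Context: Let $X=(x_{ij})$ be an $m\times n$ matrix of indeterminates over $\Bbbk$, $A_t(m,n)\subseteq\Bbbk[x_{ij}]$ the $\Bbbk$-subalgebra generated by the $t$-minors of $X$, $S_t(m,n)$ the standard graded polynomial ring over $\Bbbk$ whose variables are indexed by the $t$-minors of $X$, $\pi:S_t(m,n)\to A_t(m,n)$ the surjection sending each variable to the corresponding minor, and $J_t(m,n)=\ker\pi$. *)

(* Defs.v *)
From HB Require Import structures.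
From mathcomp Require Import all_boot all_order all_algebra.
From mathcomp Require Import mpoly.
From mathcomp Require classical_sets.

Set Implicit Arguments.
Unset Strict Implicit.
Unset Printing Implicit Defensive.

Import GRing.Theory.
Local Open Scope ring_scope.

(** * Homogeneous ideals of a polynomial ring *)

Definition in_ideal (k : fieldType) (N : nat)
    (G : seq {mpoly k[N]}) (p : {mpoly k[N]}) : Prop :=
  exists c : {mpoly k[N]} -> {mpoly k[N]}, p = \sum_(g <- G) c g * g.

Definition generates (k : fieldType) (N : nat)
    (G : seq {mpoly k[N]}) (J : {pred {mpoly k[N]}}) : Prop :=
  forall p, p \in J <-> in_ideal G p.

(** Minimality excludes [0] and repetitions: [rem g G] drops only one
    occurrence of [g]. *)
Definition min_gen_system (k : fieldType) (N : nat)
    (J : {pred {mpoly k[N]}}) (G : seq {mpoly k[N]}) : Prop :=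
  [/\ forall g, g \in G -> exists d, g \is d.-homog,
      generates G J
    & forall g, g \in G -> ~ generates (rem g G) J].

(** The zero polynomial is [d.-homog] for every [d], but it does not occur in
    a minimal system, so [d] is the degree of [g]. *)
Definition is_min_gen_degree (k : fieldType) (N : nat)
    (J : {pred {mpoly k[N]}}) (d : nat) : Prop :=
  exists G g, [/\ min_gen_system J G, g \in G & g \is d.-homog].

Definition is_max_gen_degree (k : fieldType) (N : nat)
    (J : {pred {mpoly k[N]}}) (d : nat) : Prop :=
  is_min_gen_degree J d /\ forall e, is_min_gen_degree J e -> (e <= d)%N.

(** The maximum exists for every nonzero homogeneous ideal (Hilbert's basis
    theorem and the graded Nakayama lemma); for the zero ideal, which has no
    minimal generator, the value is [0]. *)
Definition max_gen_degree (k : fieldType) (N : nat)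
    (J : {pred {mpoly k[N]}}) : nat :=
  classical_sets.xget 0%N (is_max_gen_degree J).

(** * Relations between minors *)

(** A choice of [t] of the indices [0, ..., m - 1], listed increasingly. *)
Definition is_incr (t m : nat) (f : {ffun 'I_t -> 'I_m}) : bool :=
  [forall i : 'I_t, forall j : 'I_t, (i < j)%N ==> (f i < f j)%N].

Definition incr (t m : nat) := {f : {ffun 'I_t -> 'I_m} | is_incr f}.

(** Index type of the [t]-minors of an [m x n] matrix: rows, columns. *)
Definition minor_idx (t m n : nat) : finType := (incr t m * incr t n)%type.

Definition generic_mx (k : fieldType) (m n : nat) :
    'M[{mpoly k[m * n]}]_(m, n) :=
  \matrix_(i < m, j < n) 'X_(mxvec_index i j).

Definition generic_minor (k : fieldType) (t m n : nat)
    (u : minor_idx t m n) : {mpoly k[m * n]} :=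
  \det (mxsub (val u.1) (val u.2) (generic_mx k m n)).

Definition minor_ring (k : fieldType) (t m n : nat) :=
  {mpoly k[#|minor_idx t m n|]}.

(** The variable of index [i] goes to the minor [enum_val i]. The codomain is
    the full ring [k[x_ij]] instead of the image [A_t(m,n)]. *)
Definition minor_map (k : fieldType) (t m n : nat)
    (p : minor_ring k t m n) : {mpoly k[m * n]} :=
  p \mPo [tuple generic_minor k (enum_val i) | i < #|minor_idx t m n|].

Definition minor_relations (k : fieldType) (t m n : nat) :
    {pred minor_ring k t m n} :=
  [pred p | minor_map p == 0].
Arguments minor_relations : clear implicits.

Definition max_relation_degree (k : fieldType) (t m n : nat) : nat :=
  max_gen_degree (minor_relations k t m n).

(* Main.v *)
From HB Require Import structures.
Require Import Defs.
From mathcomp Require Import all_boot all_order all_algebra all_fingroup.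
From mathcomp Require Import mpoly.
From mathcomp Require Import zify.
From mathcomp Require classical_sets boolp.

(** A minimal relation between [t]-minors cannot spread over more than [m + t]
    columns; this is why [n] may be replaced by [m + t].

    Say that degree [e] is decomposable for a homogeneous ideal if each of its
    forms of degree [e] lies in the ideal generated by its forms of smaller
    degree. The highest degree of a minimal generator is the largest degree that
    is not decomposable ([decomposable_gt_max], [max_gen_degree_le]); its
    existence is Hilbert's basis theorem, proved here from Dickson's lemma. So it
    is enough to carry decomposability of a degree from [m + t] to [n] columns.

    For this, variables [y_(r, c)] are used for all maps [c : 'I_t -> 'I_n],
    increasing or not. Sorting the columns of a minor costs linear relations
    only, so the two presentations have the same decomposable degrees from 2 on
    ([relations_decomposable]), and the only relation of degree 0 or 1 is 0. In
    the new presentation every map between sets of columns acts on relations,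
    and so do the polarizations [E_ij], the derivations that replace one
    occurrence of column [j] by column [i]. If [n <= m + t], the columns are
    embedded into [m + t] columns and retracted. If [n >= m + t], columns are added
    one at a time: let [n > m + t] and assume the claim for [n - 1] columns, so
    that a relation in which some column does not occur is decomposable.

    The Capelli element [C], the sum over the permutations [s] of
    [sgn s : E_(s 1, 1) ... E_(s n, n) :] in normal order, settles the other
    relations.
    - It kills polynomials in the entries of a matrix with fewer than [n] rows,
      because it expands into determinants with two equal rows
      ([alt_nord_eq0]). Now a form [f] is recovered, by Euler's formula, from
      its terms [y_(r, c) * df/dy_(r, c)]; when the second factor is evaluated at
      the minors it involves [m] rows, and the [t] columns listed by [c] amount to
      [t] further rows. As [m + t < n], all partial derivatives of [C f] are
      relations ([capelli_deriv]), hence [C f] is decomposable.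
    - If [f] is a relation of multidegree [lam] in the columns and all relations
      of higher weight are decomposable, then [C f] agrees with [N f] modulo
      decomposable relations, for a natural number [N] which is positive when
      every column occurs in [f] ([nord_lead]). In characteristic 0 this makes
      [f] decomposable ([highest_weight_step]).
    Induction on weights, from the highest one down, finishes the proof
    ([decomposable_of_missing_column]). *)

Set Implicit Arguments.
Unset Strict Implicit.
Unset Printing Implicit Defensive.

Import GRing.Theory.
Local Open Scope ring_scope.

(** * Polynomial rings with variables indexed by a finite type *)

Lemma natr_neq0 (k : fieldType) : [pchar k] =i pred0 ->
  forall d, (0 < d)%N -> d%:R != 0 :> k.
Proof. by move=> /pcharf0P H d; rewrite H lt0n. Qed.

Section MpolyInduction.
Variables (k : fieldType) (N : nat).

Lemma mpoly_alg_ind (P : {mpoly k[N]} -> Prop) :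
  (forall c, P c%:MP) -> (forall i, P 'X_i) ->
  (forall f g, P f -> P g -> P (f + g)) ->
  (forall f g, P f -> P g -> P (f * g)) -> forall f, P f.
Proof.
move=> Pc Px Pd Pm f; elim/mpolyind: f => [|c m f _ _ IH]; first exact: (Pc 0).
apply: (Pd _ _ _ IH); rewrite -mul_mpolyC; apply: (Pm _ _ (Pc c)).
rewrite mpolyXE_id; elim/big_rec: _ => [|i g _ Pg]; first exact: (Pc 1).
apply: (Pm _ _ _ Pg); elim: (m i) => [|e IHe]; first by rewrite expr0; exact: (Pc 1).
by rewrite exprS; apply: Pm.
Qed.

Lemma mpoly_span_ind (P : {mpoly k[N]} -> Prop) :
  P 0 -> (forall f g, P f -> P g -> P (f + g)) ->
  (forall c f, P f -> P (c *: f)) -> forall f,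
  (forall m, m \in msupp f -> P 'X_[m]) -> P f.
Proof.
move=> P0 Pd Pz f Pm; rewrite [f]mpolyE big_seq.
by elim/big_rec: _ => // m g /Pm mP Pg; apply: Pd => //; apply: Pz.
Qed.

End MpolyInduction.

Section IndexedVariables.
Variables (k : fieldType) (U : finType).
Notation S := {mpoly k[#|U|]}.

Definition var (u : U) : S := 'X_(enum_rank u).

Definition subst (M : nat) (v : U -> {mpoly k[M]}) (p : S) : {mpoly k[M]} :=
  p \mPo [tuple v (enum_val i) | i < #|U|].

Lemma var_enum_val i : var (enum_val i) = 'X_i.
Proof. by rewrite /var enum_valK. Qed.

(** The [k]-linear derivation with value [v u] on the variable [u]. *)
Definition der (v : U -> S) (p : S) : S := \sum_u v u * p^`M(enum_rank u).

End IndexedVariables.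

Section Subst.
Variables (k : fieldType) (U : finType) (M : nat) (v : U -> {mpoly k[M]}).
Notation S := {mpoly k[#|U|]}.
HB.instance Definition _ := GRing.RMorphism.copy (subst v)
  (comp_mpoly [tuple v (enum_val i) | i < #|U|]).
HB.instance Definition _ := GRing.Linear.copy (subst v)
  (comp_mpoly [tuple v (enum_val i) | i < #|U|]).

Lemma substC c : subst v c%:MP = c%:MP.
Proof. exact: comp_mpolyC. Qed.
Lemma subst_var u : subst v (var k u) = v u.
Proof. by rewrite /subst comp_mpolyXU -tnth_nth tnth_mktuple enum_rankK. Qed.
End Subst.

Section Derivation.
Variables (k : fieldType) (U : finType).
Notation S := {mpoly k[#|U|]}.
Implicit Types (f g : S) (v : U -> S).

Lemma der_is_linear v : linear (der v).
Proof.
move=> c f g; rewrite /der scaler_sumr -big_split /=; apply: eq_bigr => u _.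
by rewrite linearP /= mulrDr scalerAr.
Qed.
HB.instance Definition _ v := GRing.isLinear.Build k S S _ (der v) (der_is_linear v).

Lemma derM v f g : der v (f * g) = der v f * g + f * der v g.
Proof.
rewrite /der mulr_suml mulr_sumr -big_split; apply: eq_bigr => u _ /=.
by rewrite mderivM mulrDr; congr (_ + _); rewrite ?mulrA // [f * _]mulrC.
Qed.

Lemma derC v c : der v c%:MP = 0.
Proof. by rewrite /der big1 // => u _; rewrite mderivC mulr0. Qed.

Lemma der_var v u : der v (var k u) = v u.
Proof.
rewrite /der (bigD1 u) //= big1 ?addr0.
  rewrite /var mderivX mnm1E eqxx scale1r.
  suff ->: (U_(enum_rank u) - U_(enum_rank u) = 0 :> 'X_{1.. #|U|})%MM.
    by rewrite mpolyX0 mulr1.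
  by apply/mnmP => i; rewrite mnmBE mnm0E subnn.
move=> w neq; rewrite /var mderivX mnm1E (inj_eq enum_rank_inj) eq_sym.
by rewrite (negbTE neq) scale0r mulr0.
Qed.

Lemma der_prod v (I : eqType) (L : seq I) (F : I -> S) : uniq L ->
  der v (\prod_(q <- L) F q) =
  \sum_(q <- L) der v (F q) * \prod_(p <- L | p != q) F p.
Proof.
elim: L => [|j L IH] /=; first by rewrite !big_nil -mpolyC1 derC.
case/andP=> jL uL; rewrite !big_cons derM (IH uL) eqxx /= mulr_sumr.
congr (_ * _ + _).
  rewrite big_seq [RHS]big_seq_cond; apply: eq_bigl => p.
  by case: eqP => [->|]; rewrite ?andbT // (negbTE jL).
rewrite [LHS]big_seq [RHS]big_seq; apply: eq_bigr => q qL.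
rewrite big_cons; case: eqP => [jq|_]; first by rewrite jq qL in jL.
by rewrite mulrCA.
Qed.
End Derivation.

Section Weight.
Variables (U : finType).

Definition wt (h : U -> nat) (m : 'X_{1.. #|U|}) : nat :=
  (\sum_u m (enum_rank u) * h u)%N.

Lemma wt0 h : wt h 0%MM = 0%N.
Proof. by rewrite /wt big1 // => u _; rewrite mnm0E. Qed.
Lemma wtD h : {morph wt h : m1 m2 / (m1 + m2)%MM >-> (m1 + m2)%N}.
Proof.
move=> m1 m2; rewrite /wt -big_split; apply: eq_bigr => u _ /=.
by rewrite mnmDE mulnDl.
Qed.
HB.instance Definition _ h := isMeasure.Build #|U| (wt h) (wt0 h) (wtD h).

Lemma wt_mnm1 h u : wt h U_(enum_rank u)%MM = h u.
Proof.
rewrite /wt (bigD1 u) //= big1 ?mnm1E ?eqxx ?mul1n ?addn0 // => w neq.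
by rewrite mnm1E (inj_eq enum_rank_inj) eq_sym (negbTE neq).
Qed.

Lemma wt_const c m : wt (fun=> c) m = (mdeg m * c)%N.
Proof.
rewrite /wt -big_distrl /= mdegE; congr (_ * _)%N.
rewrite (reindex (@enum_val U predT)) /=; last first.
  by exists enum_rank => i _; rewrite ?enum_rankK ?enum_valK.
by apply: eq_bigr => i _; rewrite enum_valK.
Qed.

Lemma wt_sum (I : Type) (r : seq I) (P : pred I) (h : I -> U -> nat) m :
  wt (fun u => \sum_(i <- r | P i) h i u)%N m = (\sum_(i <- r | P i) wt (h i) m)%N.
Proof.
by rewrite /wt exchange_big; apply: eq_bigr => u _ /=; rewrite big_distrr.
Qed.

Lemma eq_wt h h' : h =1 h' -> wt h =1 wt h'.
Proof. by move=> e m; apply: eq_bigr => u _; rewrite e. Qed.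

Lemma wtZ h c m : wt (fun u => c * h u)%N m = (c * wt h m)%N.
Proof. by rewrite /wt big_distrr; apply: eq_bigr => u _; rewrite mulnCA. Qed.
End Weight.

Section WeightDer.
Variables (k : fieldType) (U : finType).
Notation S := {mpoly k[#|U|]}.
Implicit Types (f g : S) (v : U -> S).

(** All monomials of [f] have weight [a - b]. Weights move up and down along
    polarizations, and the difference is kept as a pair of naturals so that no
    truncated subtraction occurs. *)
Definition wt_shift (h : U -> nat) a b f :=
  forall m, m \in msupp f -> (wt h m + b = a)%N.

(** If [v u] has weight [h u + a - b] for every [u], differentiation along [v]
    shifts all weights by [a - b], as it trades a factor [u] for [v u]. *)
Lemma wt_shift_der h v a b :
  (forall u, wt_shift h (h u + a) b (v u)) -> forall c d f, wt_shift h c d f ->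
  wt_shift h (c + a) (d + b) (der v f).
Proof.
move=> hv c d f hf m /msupp_sum_le /flattenP [l /mapP [u _ ->]].
move=> /msuppM_le /allpairsP [[m1 m2] /= [m1v m2f ->]].
have := hv _ _ m1v; move: m2f; rewrite mcoeff_msupp mcoeff_mderiv => nz.
have /hf: (m2 + U_(enum_rank u))%MM \in msupp f.
  by rewrite mcoeff_msupp; apply: contraNneq nz => ->; rewrite mul0rn.
by rewrite !wtD wt_mnm1 => <- e; lia.
Qed.

Lemma dhomog_der v d f : (forall u, v u \is 1.-homog) -> f \is d.-homog ->
  der v f \is d.-homog.
Proof.
move=> hv /dhomogP hf; apply/dhomogP => m mf /=.
have E m' : wt (fun=> 1%N) m' = mdeg m' by rewrite wt_const muln1.
have := @wt_shift_der (fun=> 1%N) v 0 0 _ d 0 f _ m mf.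
rewrite E !addn0; apply.
  by move=> u m' m'v; rewrite E !addn0; apply: (dhomog_mf (hv u)).
by move=> m' m'f; rewrite E addn0; apply: hf.
Qed.

(** Generalized Euler formula: the derivation that scales each variable by its
    weight acts on a weighted form as its weight. *)
Lemma der_scale_var h d f : f \is d.-homog for (wt h) ->
  der (fun u => (h u)%:R *: var k u) f = d%:R *: f.
Proof.
move=> /dhomogP hf; apply: (@mpoly_span_ind _ _ (fun f => der _ f = d%:R *: f))
  => [|g g' E E'|c g E|m mf].
- by rewrite linear0 scaler0.
- by rewrite linearD scalerDr /= E E'.
- by rewrite linearZ /= E !scalerA mulrC.
rewrite -(hf m mf).
rewrite /der /= /wt natr_sum scaler_suml; apply: eq_bigr => u _.
rewrite mderivX -scalerAr -scalerAl scalerA natrM /var -mpolyXD.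
have [->|nz] := eqVneq (m (enum_rank u)) 0%N; first by rewrite !mul0r !scale0r.
by rewrite addmC submK // lep1mP.
Qed.

Lemma euler d f : f \is d.-homog -> der (@var k U) f = d%:R *: f.
Proof.
move=> hf; rewrite -(@der_scale_var (fun=> 1%N)).
  by apply: eq_bigr => u _; rewrite scale1r.
by apply/dhomogP => m mf; rewrite /= wt_const muln1; apply: (dhomog_mf hf).
Qed.
End WeightDer.

Section WtShift.
Variables (k : fieldType) (U : finType) (h : U -> nat).
Notation S := {mpoly k[#|U|]}.
Implicit Types (f g : S).

Lemma wt_shift0 a b : wt_shift h a b (0 : S).
Proof. by move=> m; rewrite msupp0. Qed.

Lemma wt_shiftB a b f g : wt_shift h a b f -> wt_shift h a b g -> wt_shift h a b (f - g).
Proof. by move=> hf hg m /msuppB_le; rewrite mem_cat => /orP [/hf|/hg]. Qed.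

Lemma wt_shiftD a b f g : wt_shift h a b f -> wt_shift h a b g -> wt_shift h a b (f + g).
Proof. by move=> hf hg m /msuppD_le; rewrite mem_cat => /orP [/hf|/hg]. Qed.

Lemma wt_shift_sum a b (I : Type) (r : seq I) (C : pred I) (F : I -> S) :
  (forall i, C i -> wt_shift h a b (F i)) -> wt_shift h a b (\sum_(i <- r | C i) F i).
Proof.
by move=> H; apply: (big_ind (wt_shift h a b)) => //; [exact: wt_shift0|exact: wt_shiftD].
Qed.

Lemma wt_shift_eq a b a' b' f :
  (a + b' = a' + b)%N -> wt_shift h a b f -> wt_shift h a' b' f.
Proof. by move=> e hf m /hf; lia. Qed.

End WtShift.

Lemma eq_der (k : fieldType) (U : finType) (v w : U -> {mpoly k[#|U|]}) f :
  v =1 w -> der v f = der w f.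
Proof. by move=> e; apply: eq_bigr => u _; rewrite e. Qed.

Lemma dhomog_mderiv (k : fieldType) N i d (f : {mpoly k[N]}) :
  f \is d.-homog -> f^`M(i) \is d.-1.-homog.
Proof.
move=> /dhomogP hf; apply/dhomogP => m; rewrite mcoeff_msupp mcoeff_mderiv => nz /=.
have /hf /= <- : (m + U_(i))%MM \in msupp f.
  by rewrite mcoeff_msupp; apply: contraNneq nz => ->; rewrite mul0rn.
by rewrite mdegD mdeg1 addn1.
Qed.

Section SubstWeight.
Variables (k : fieldType) (U : finType) (M : nat) (v : U -> {mpoly k[M]}).
Notation S := {mpoly k[#|U|]}.

Lemma substX m : subst v 'X_[m] = \prod_u v u ^+ m (enum_rank u).
Proof.
rewrite /subst comp_mpolyX (reindex (@enum_rank U)) /=.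
  by apply: eq_bigr => u _; rewrite tnth_mktuple enum_rankK.
by exists enum_val => i _; rewrite ?enum_rankK ?enum_valK.
Qed.

Lemma dhomog_substX h (mf : measure M) m :
  (forall u, v u \is (h u).-homog for mf) ->
  subst v 'X_[m] \is (wt h m).-homog for mf.
Proof.
move=> hv; rewrite substX /wt.
elim/big_rec2: _ => [|u d g _ hg]; first exact: dhomog1.
apply: dhomogM hg; rewrite mulnC; exact: dhomogMn.
Qed.

(** A substitution which respects the gradings commutes with taking
    homogeneous components, so that its kernel is a graded ideal. *)
Lemma subst_pihomog h (mf : measure M) d (f : S) :
  (forall u, v u \is (h u).-homog for mf) ->
  subst v (pihomog (wt h) d f) = pihomog mf d (subst v f).
Proof.
move=> hv;
apply: (@mpoly_span_ind _ _
  (fun f => subst v (pihomog _ _ f) = pihomog _ _ (subst v f)))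
  => [|g g' E E'|c g E|m _].
- by rewrite !linear0.
- by rewrite !linearD /= E E'.
- by rewrite !linearZ /= E.
rewrite pihomogX /=; have hX := dhomog_substX m hv.
case: eqP => [<-|/eqP ne]; first by rewrite pihomog_dE.
by rewrite linear0 (pihomog_ne0 ne hX).
Qed.

Lemma dhomog_subst d f : (forall u, v u \is 1.-homog) -> f \is d.-homog ->
  subst v f \is d.-homog.
Proof.
move=> hv /dhomogP hf; apply: (@mpoly_span_ind _ _ (fun f => subst v f \is d.-homog))
  => [|g g'|c g|m mf].
- by rewrite linear0 dhomog0.
- by rewrite linearD /=; apply: dhomogD.
- by rewrite linearZ /=; apply: dhomogZ.
have := @dhomog_substX (fun=> 1%N) (mdeg : measure M) m hv.
by rewrite wt_const muln1 (hf m mf).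
Qed.
End SubstWeight.

Section SubstComp.
Variables (k : fieldType) (U V : finType) (M : nat).

Lemma subst_comp (w : V -> {mpoly k[M]}) (v : U -> {mpoly k[#|V|]}) f :
  subst w (subst v f) = subst (fun u => subst w (v u)) f.
Proof.
apply: (@mpoly_alg_ind _ _ (fun f => subst w (subst v f) = subst _ f))
  => [c|i|g g' E E'|g g' E E'].
- by rewrite !substC.
- by rewrite -var_enum_val !subst_var.
- by rewrite !rmorphD /= E E'.
- by rewrite !rmorphM /= E E'.
Qed.

Lemma eq_subst (v w : U -> {mpoly k[M]}) f : v =1 w -> subst v f = subst w f.
Proof.
move=> e; apply: (@mpoly_alg_ind _ _ (fun f => subst v f = subst w f))
  => [c|i|g g' E E'|g g' E E'].
- by rewrite !substC.
- by rewrite -var_enum_val !subst_var.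
- by rewrite !rmorphD /= E E'.
- by rewrite !rmorphM /= E E'.
Qed.

Lemma subst_id_supp (v : U -> {mpoly k[#|U|]}) f :
  (forall m u, m \in msupp f -> m (enum_rank u) != 0%N -> v u = var k u) ->
  subst v f = f.
Proof.
move=> hv; apply: (@mpoly_span_ind _ _ (fun f => subst v f = f))
  => [|g g' E E'|c g E|m mf].
- exact: linear0.
- by rewrite linearD /= E E'.
- by rewrite linearZ /= E.
rewrite substX mpolyXE_id (reindex (@enum_val U predT)) /=; last first.
  by exists enum_rank => i _; rewrite ?enum_rankK ?enum_valK.
apply: eq_bigr => i _; rewrite enum_valK.
have [->|nz] := eqVneq (m i) 0%N; first by rewrite !expr0.
by rewrite (hv m) ?var_enum_val ?enum_valK.
Qed.
End SubstComp.

Lemma msupp_pihomog (k : fieldType) N (mf : measure N) d (f : {mpoly k[N]}) :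
  {subset msupp (pihomog mf d f) <= msupp f}.
Proof.
move=> m; rewrite pihomogE => /msupp_sum_le /flattenP [l /mapP [m' m'f ->]].
move/msuppZ_le; rewrite msuppX mem_seq1 => /eqP ->.
by move: m'f; rewrite mem_filter => /andP [].
Qed.

Lemma dhomog_pihomog (k : fieldType) N (mf mf' : measure N) d e (f : {mpoly k[N]}) :
  f \is e.-homog for mf' -> pihomog mf d f \is e.-homog for mf'.
Proof. by move=> /dhomogP hf; apply/dhomogP => m /msupp_pihomog /hf. Qed.

Definition upd (I : eqType) (J : Type) (i : I -> J) q p : I -> J :=
  fun x => if x == q then p else i x.

(** * Normally ordered products of polarizations *)

Section NormalOrder.
Variables (n : nat).
Implicit Types (L : seq 'I_n) (i : 'I_n -> 'I_n).

(** For operators [E i j = \sum_a x_ai d/dx_aj] this is the normally ordered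
    product [: \prod_(q <- L) E (i q) q :], in which all multiplications stand
    to the left of all derivatives. It is defined by recursion, from
    [E_ij :P: = : E_ij P : + (contractions)], where a contraction lets [d/dx_aj]
    hit a factor [x_aj] and turns it into [x_ai]. As only the operators [E] occur,
    the definition makes sense for every action, is preserved by equivariant
    maps, and preserves subspaces stable under [E]. *)
Fixpoint nord (T : zmodType) (E : 'I_n -> 'I_n -> T -> T) L i (f : T) : T :=
  if L is j :: L' then
    E (i j) j (nord E L' i f) - \sum_(q <- L' | i q == j) nord E L' (upd i q (i j)) f
  else f.

Lemma eq_nord (T : zmodType) (E : 'I_n -> 'I_n -> T -> T) L i i' f :
  {in L, i =1 i'} -> nord E L i f = nord E L i' f.
Proof.
elim: L i i' => //= j L IH i i' e.
have ej := e j (mem_head _ _).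
have eL : {in L, i =1 i'} by move=> q qL; apply: e; rewrite inE qL orbT.
rewrite ej (IH i i' eL); congr (_ - _).
rewrite big_seq_cond [RHS]big_seq_cond; apply: eq_big => [q|q /andP [qL _]].
  by case qL: (q \in L); rewrite //= eL.
by apply: IH => x xL; rewrite /upd eL.
Qed.

Lemma nord_comm (T T' : zmodType) (phi : {additive T -> T'})
    (E : 'I_n -> 'I_n -> T -> T) (E' : 'I_n -> 'I_n -> T' -> T') :
  (forall p q f, phi (E p q f) = E' p q (phi f)) ->
  forall L i f, phi (nord E L i f) = nord E' L i (phi f).
Proof.
move=> hphi; elim=> //= j L IH i f.
rewrite raddfB /= hphi IH raddf_sum; congr (_ - _).
by apply: eq_bigr => q _; rewrite IH.
Qed.

Lemma nord_closed (T : zmodType) (E : 'I_n -> 'I_n -> T -> T) (P : T -> Prop) :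
  P 0 -> (forall f g, P f -> P g -> P (f - g)) -> (forall p q f, P f -> P (E p q f)) ->
  forall L i f, P f -> P (nord E L i f).
Proof.
move=> P0 PB PE.
have PD f g : P f -> P g -> P (f + g).
  by move=> Pf Pg; rewrite -[g]opprK -[- g]sub0r; apply: (PB) => //; apply: PB.
elim=> //= j L IH i f Pf; apply: PB; first by apply/PE/IH.
by apply: (big_ind P) => // q _; apply: IH.
Qed.

End NormalOrder.

Lemma sgn_scale (k : fieldType) N (b : bool) (h : {mpoly k[N]}) :
  (-1) ^+ b * h = (-1) ^+ b *: h.
Proof. by rewrite mulr_sign scaler_sign. Qed.

(** * Polarization of matrix entries and of minors *)

Section MatrixRing.
Variables (k : fieldType) (A : finType) (n : nat).
Notation R := {mpoly k[#|{: A * 'I_n}|]}.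
Implicit Types (h : R).

Definition xvar (a : A) (j : 'I_n) : R := var k (a, j).

(** Polarization: [\sum_a x_ai d/dx_aj]. *)
Definition xpol (i j : 'I_n) : R -> R :=
  der (fun u : A * 'I_n => (u.2 == j)%:R *: xvar u.1 i).
HB.instance Definition _ i j := GRing.Linear.on (xpol i j).

Lemma xpolM i j f g : xpol i j (f * g) = xpol i j f * g + f * xpol i j g.
Proof. exact: derM. Qed.
Lemma xpol_xvar i j a b : xpol i j (xvar a b) = (b == j)%:R *: xvar a i.
Proof. exact: der_var. Qed.

Lemma xpol_monomial (I : eqType) (L : seq I) (a : I -> A) (c : I -> 'I_n) i j :
  uniq L -> xpol i j (\prod_(q <- L) xvar (a q) (c q)) =
  \sum_(q <- L | c q == j) \prod_(p <- L) xvar (a p) (upd c q i p).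
Proof.
move=> uL; rewrite /xpol der_prod // [RHS]big_mkcond /= big_seq [RHS]big_seq.
apply: eq_bigr => q qL; rewrite -/(xpol i j) xpol_xvar.
case: eqP => _; last by rewrite scale0r mul0r.
rewrite scale1r (bigD1_seq q) //= /upd eqxx; congr (_ * _).
by apply: eq_bigr => p /negbTE ->.
Qed.

Lemma xpolE i j h : xpol i j h = \sum_a xvar a i * h^`M(enum_rank (a, j)).
Proof.
pose F (u : A * 'I_n) : R := (u.2 == j)%:R *: xvar u.1 i.
rewrite -[LHS]/(der F h) /der.
rewrite (eq_bigr (fun u => F (u.1, u.2) * h^`M(enum_rank (u.1, u.2)))); last by case.
rewrite -(pair_bigA _ (fun a b => F (a, b) * h^`M(enum_rank (a, b)))) /=; apply: eq_bigr => a _.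
rewrite (bigD1 j) //= /F /= eqxx scale1r big1 ?addr0 // => b /negbTE ->.
by rewrite scale0r mul0r.
Qed.

(** On polynomials in the matrix entries the normally ordered product is the sum,
    over maps [a] from [L] to the rows, of
    [(\prod_q x_(a q, i q)) * (\prod_q d/dx_(a q, q)) h]. What matters is that the
    list [F] of pairs (map, iterated derivative) serves all [i] at once. The
    row [a0] is a default value of the maps outside [L]. *)
Lemma nord_expand (a0 : A) L h : uniq L ->
  exists F : seq (('I_n -> A) * R), forall i,
    nord xpol L i h = \sum_(x <- F) (\prod_(q <- L) xvar (x.1 q) (i q)) * x.2.
Proof.
elim: L => [_|j L IH /= /andP [jL uL]].
  by exists [:: (fun=> a0, h)] => i; rewrite big_seq1 big_nil mul1r.
have [F hF] := IH uL.
exists [seq (upd x.1 j b, (x.2)^`M(enum_rank (b, j))) | x <- F, b <- enum A] => i.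
rewrite hF (eq_bigr _ (fun q _ => hF _)) big_allpairs_dep /= raddf_sum.
rewrite [X in _ - X]exchange_big -sumrB; apply: eq_bigr => x _ /=.
(* differentiating the monomials gives exactly the contractions, which cancel *)
rewrite xpolM xpol_monomial // mulr_suml -addrA [X in _ + X]addrC addrA subrr add0r.
rewrite xpolE mulr_sumr big_enum; apply: eq_bigr => b _ /=.
rewrite big_cons {1}/upd eqxx mulrA [_ * xvar _ _]mulrC.
congr (_ * _ * _); rewrite big_seq [RHS]big_seq; apply: eq_bigr => q qL.
by rewrite /upd; case: eqP => // qj; rewrite -qj qL in jL.
Qed.

(** Capelli: by [nord_expand] the alternating sum is a combination of
    determinants with rows [a q], and a map from [n] indices to fewer than
    [n] rows repeats a value. *)
Lemma alt_nord_eq0 (a0 : A) h : (#|A| < n)%N ->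
  \sum_(s : 'S_n) (-1) ^+ s *: nord xpol (enum 'I_n) s h = 0.
Proof.
move=> ltA; have [F hF] := nord_expand a0 h (enum_uniq 'I_n).
rewrite (eq_bigr _ (fun (s : 'S_n) _ => congr1 _ (hF s))).
under eq_bigr => s _ do rewrite scaler_sumr.
rewrite exchange_big big1 // => -[a g] _ /=.
under eq_bigr => s _ do rewrite scalerAl -sgn_scale big_enum.
rewrite -mulr_suml.
suff -> : \sum_(s : 'S_n) (-1) ^+ s * \prod_q xvar (a q) (s q) = 0 by rewrite mul0r.
have /injectivePn [q [q' neq eqa]] : ~~ injectiveb a.
  by apply/injectiveP => /leq_card; rewrite card_ord leqNgt ltA.
have := @determinant_alternate _ _ (\matrix_(q, p) xvar (a q) p) _ _ neq.
have H : (\matrix_(q, p) xvar (a q) p) q =1 (\matrix_(q, p) xvar (a q) p) q'.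
  by move=> p; rewrite !mxE eqa.
move=> /(_ H) det0; rewrite -[RHS]det0; apply: eq_bigr => s _; congr (_ * _).
by apply: eq_bigr => p _; rewrite mxE.
Qed.

Section Minor.
Variable t : nat.

Definition xminor (r : 'I_t -> A) (c : 'I_t -> 'I_n) : R :=
  \det (\matrix_(a, b) xvar (r a) (c b)).

Lemma xminorE r c :
  xminor r c = \sum_(s : 'S_t) (-1) ^+ s * \prod_(l <- index_enum 'I_t) xvar (r (s l)) (c l).
Proof.
rewrite /xminor -det_tr; apply: eq_bigr => s _; congr (_ * _).
by apply: eq_bigr => l _; rewrite !mxE.
Qed.

Lemma xpol_xminor i j r c :
  xpol i j (xminor r c) = \sum_(l | c l == j) xminor r (upd c l i).
Proof.
rewrite xminorE linear_sum /=.
under eq_bigr => s _.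
  rewrite sgn_scale linearZ /= xpol_monomial ?index_enum_uniq // scaler_sumr; over.
rewrite exchange_big; apply: eq_bigr => l _; rewrite xminorE.
by apply: eq_bigr => s _; rewrite sgn_scale.
Qed.

Lemma dhomog_xminor (h : 'I_n -> nat) r c :
  xminor r c \is (\sum_l h (c l)).-homog for (wt (fun u : A * 'I_n => h u.2)).
Proof.
rewrite xminorE; apply: rpred_sum => s _; rewrite sgn_scale; apply: rpredZ.
elim/big_rec2: _ => [|l g d _ hg]; first exact: dhomog1.
by apply: dhomogM hg; rewrite dhomogX /= wt_mnm1.
Qed.
End Minor.
End MatrixRing.

Section UnsortedMinors.
Variables (k : fieldType) (A B : finType) (t n : nat) (rows : B -> 'I_t -> A).
Notation idx := (B * {ffun 'I_t -> 'I_n})%type.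
Notation S := {mpoly k[#|{: idx}|]}.
Notation R := {mpoly k[#|{: (A + 'I_t) * 'I_n}|]}.

(** The variable attached to the minor with rows [rows r] and columns [c]. *)
Definition yvar (r : B) (c : 'I_t -> 'I_n) : S := var k (r, [ffun l => c l]).

(** The derivation through which the polarization [xpol i j] acts on the formal
    minors: one occurrence of column [j] becomes column [i]. *)
Definition ypol (i j : 'I_n) : S -> S :=
  der (fun u : idx => \sum_(l | u.2 l == j) yvar u.1 (upd u.2 l i)).
HB.instance Definition _ i j := GRing.Linear.on (ypol i j).

Definition prow (r : B) : 'I_t -> A + 'I_t := fun a => inl (rows r a).

(** Evaluation of the formal minors. The target has [t] additional rows,
    absent from the minors themselves; they carry the variables of [zmono]. *)
Definition yeval : S -> R := subst (fun u : idx => xminor k (prow u.1) u.2).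
HB.instance Definition _ := GRing.RMorphism.on yeval.
HB.instance Definition _ := GRing.Linear.on yeval.

Lemma eq_xminor (r : 'I_t -> A + 'I_t) (c c' : 'I_t -> 'I_n) :
  c =1 c' -> xminor k r c = xminor k r c'.
Proof. by move=> e; congr (\det _); apply/matrixP => a b; rewrite !mxE e. Qed.

Lemma yeval_yvar r c : yeval (yvar r c) = xminor k (prow r) c.
Proof. by rewrite /yeval subst_var /=; apply: eq_xminor => l; rewrite ffunE. Qed.

Lemma ypol_var i j u :
  ypol i j (var k u) = \sum_(l | u.2 l == j) yvar u.1 (upd u.2 l i).
Proof. exact: der_var. Qed.
Lemma ypolM i j f g : ypol i j (f * g) = ypol i j f * g + f * ypol i j g.
Proof. exact: derM. Qed.

Lemma yeval_ypol i j f : yeval (ypol i j f) = xpol i j (yeval f).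
Proof.
apply: (@mpoly_alg_ind _ _ (fun f => yeval (ypol i j f) = xpol i j (yeval f)))
  => [c|q|g g' E E'|g g' E E'].
- by rewrite [ypol _ _ _]derC raddf0 [yeval _]substC [RHS]derC.
- rewrite -var_enum_val ypol_var [in RHS]/yeval subst_var xpol_xminor raddf_sum.
  by apply: eq_bigr => l _; rewrite [LHS]yeval_yvar.
- by rewrite !raddfD /= E E'.
- by rewrite ypolM rmorphD !rmorphM /= E E' xpolM.
Qed.

Section Lift.
Variable r0 : B.

Definition zmono (c : 'I_t -> 'I_n) : R :=
  \prod_(l <- index_enum 'I_t) xvar k (inr l) (c l).

(** Linearization at the minors with rows [r0]: the derivation over [yeval]
    which sends the formal minor with columns [c] to the monomial
    [\prod_l z_(l, c l)] in the additional rows. Distinct [c] have distinct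
    monomials, so [zlin r0 f] determines all [yeval (df/dy_(r0, c))]; and its
    values are polynomials in only [#|A| + t] rows. *)
Definition zlin (f : S) : R :=
  \sum_(c : {ffun 'I_t -> 'I_n}) zmono c * yeval f^`M(enum_rank (r0, c)).

Lemma zlin_is_linear : linear zlin.
Proof.
move=> a f g; rewrite /zlin scaler_sumr -big_split /=; apply: eq_bigr => c _.
by rewrite !linearP /= mulrDr scalerAr.
Qed.
HB.instance Definition _ := GRing.isLinear.Build k S R _ zlin zlin_is_linear.

Lemma zlinM f g : zlin (f * g) = zlin f * yeval g + yeval f * zlin g.
Proof.
rewrite /zlin mulr_suml mulr_sumr -big_split /=; apply: eq_bigr => c _.
rewrite mderivM rmorphD !rmorphM mulrDr mulrA; congr (_ + _).
by rewrite mulrCA.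
Qed.

Lemma zlinC c : zlin c%:MP = 0.
Proof. by rewrite /zlin big1 // => a _; rewrite mderivC raddf0 mulr0. Qed.

Lemma zlin_var u : zlin (var k u) = (u.1 == r0)%:R *: zmono u.2.
Proof.
have E c : yeval (var k u)^`M(enum_rank (r0, c)) = ((r0, c) == u)%:R.
  rewrite /var mderivX mnm1E (inj_eq enum_rank_inj) eq_sym.
  case: eqP => [->|_]; last by rewrite scale0r raddf0.
  rewrite scale1r.
  suff ->: (U_(enum_rank u) - U_(enum_rank u) = 0 :> 'X_{1.. #|{:idx}|})%MM.
    by rewrite mpolyX0 rmorph1.
  by apply/mnmP => i; rewrite mnmBE mnm0E subnn.
rewrite /zlin (eq_bigr _ (fun c _ => congr1 _ (E c))).
case: u {E} => r c0 /=; rewrite (bigD1 c0) //= big1.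
  rewrite xpair_eqE eqxx andbT eq_sym addr0.
  by case: eqP; rewrite ?mulr1 ?scale1r ?mulr0 ?scale0r.
by move=> c neq; rewrite xpair_eqE (negbTE neq) andbF mulr0.
Qed.

Lemma zmono_ext c c' : c =1 c' -> zmono c = zmono c'.
Proof. by move=> e; apply: eq_bigr => l _; rewrite e. Qed.

(** Both sides differ by a derivation over [yeval], hence agree once they
    agree on the variables. *)
Lemma zlin_ypol i j f : zlin (ypol i j f) = xpol i j (zlin f).
Proof.
apply: (@mpoly_alg_ind _ _ (fun f => zlin (ypol i j f) = xpol i j (zlin f)))
  => [c|q|g g' E E'|g g' E E'].
- by rewrite [ypol _ _ _]derC zlinC !raddf0.
- rewrite -var_enum_val ypol_var zlin_var linearZ /= xpol_monomial ?index_enum_uniq //.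
  rewrite linear_sum scaler_sumr; apply: eq_bigr => l _ /=.
  by rewrite zlin_var /=; congr (_ *: _); apply: zmono_ext => x; rewrite ffunE.
- by rewrite !raddfD /= E E'.
- by rewrite ypolM [LHS]linearD /= !zlinM [RHS]linearD /= !xpolM E E' -!yeval_ypol addrACA.
Qed.

(** Setting [z_(l, j)] to 1 if [j = c l] and to 0 otherwise singles out the
    monomial of [c] in [zlin]. *)
Definition zspec (c : 'I_t -> 'I_n) : R -> R :=
  subst (fun u : (A + 'I_t) * 'I_n =>
    if u.1 is inr l then (u.2 == c l)%:R else var k u).
HB.instance Definition _ c := GRing.RMorphism.on (zspec c).

Lemma zspec_yeval c f : zspec c (yeval f) = yeval f.
Proof.
rewrite /zspec /yeval subst_comp; apply: eq_subst => u.
rewrite -/(zspec c) /xminor -det_map_mx /=; congr (\det _).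
by apply/matrixP => a b; rewrite !mxE [LHS]subst_var.
Qed.

Lemma zspec_zlin (c : {ffun 'I_t -> 'I_n}) f : zspec c (zlin f) = yeval f^`M(enum_rank (r0, c)).
Proof.
rewrite /zlin rmorph_sum (bigD1 c) //= big1 => [|c' neq].
  rewrite addr0 rmorphM /= zspec_yeval /zmono rmorph_prod big1 ?mul1r // => l _.
  by rewrite [LHS]subst_var /= eqxx.
rewrite rmorphM /= /zmono rmorph_prod.
suff [l nl] : exists l, c' l != c l.
  rewrite (bigD1 l) //= {1}/zspec subst_var /= (negbTE nl).
  by rewrite !mul0r.
apply/existsP; apply: contraR neq => /existsPn H.
by apply/eqP/ffunP => l; apply/eqP/negPn/H.
Qed.
End Lift.

Definition capelli (f : S) : S :=
  \sum_(s : 'S_n) (-1) ^+ s *: nord ypol (enum 'I_n) s f.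

Hypotheses (t_gt0 : (0 < t)%N) (lt_n : (#|A| + t < n)%N).

Lemma zlin_capelli r0 f : zlin r0 (capelli f) = 0.
Proof.
rewrite /capelli linear_sum /=.
under eq_bigr => s _.
  rewrite linearZ /= (nord_comm (phi := zlin r0) (@zlin_ypol r0)); over.
apply: alt_nord_eq0; first by right; exact: Ordinal t_gt0.
by rewrite card_sum card_ord.
Qed.

(** [zlin] is equivariant and takes values in a polynomial ring with [#|A| + t]
    rows, where the Capelli element vanishes. *)
Lemma capelli_deriv f u : yeval (capelli f)^`M(enum_rank u) = 0.
Proof.
by case: u => r c; rewrite -zspec_zlin zlin_capelli raddf0.
Qed.

End UnsortedMinors.

(** * Forms decomposable in an ideal *)

Section Span.
Variables (k : fieldType) (N : nat).
Notation S := {mpoly k[N]}.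
Implicit Types (P Q : S -> Prop) (f g : S).

Inductive span P : S -> Prop :=
| span0 : span P 0
| span_cons c g f : P g -> span P f -> span P (c * g + f).

Lemma span_gen P g : P g -> span P g.
Proof.
by move=> Pg; rewrite -[g]mul1r -[_ * _]addr0; apply: span_cons => //; exact: span0.
Qed.

Lemma spanD P f g : span P f -> span P g -> span P (f + g).
Proof.
move=> Pf Pg; elim: Pf => [|c h f' Ph _ IH]; first by rewrite add0r.
by rewrite -addrA; apply: span_cons.
Qed.

Lemma spanM P c f : span P f -> span P (c * f).
Proof.
elim=> [|a h f' Ph _ IH]; first by rewrite mulr0; exact: span0.
by rewrite mulrDr mulrA; apply: span_cons.
Qed.

Lemma spanZ P c f : span P f -> span P (c *: f).
Proof. by rewrite -mul_mpolyC; apply: spanM. Qed.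

Lemma spanB P f g : span P f -> span P g -> span P (f - g).
Proof. by move=> Pf Pg; apply: spanD => //; rewrite -scaleN1r; apply: spanZ. Qed.

Lemma span_subD P a b c d :
  span P (a - c) -> span P (b - d) -> span P (a + b - (c + d)).
Proof. by move=> Pac Pbd; rewrite opprD addrACA; apply: spanD. Qed.

Lemma span_subM P a b c d :
  span P (a - c) -> span P (b - d) -> span P (a * b - c * d).
Proof.
move=> Pac Pbd; have -> : a * b - c * d = a * (b - d) + d * (a - c).
  by rewrite !mulrBr addrA [a * d]mulrC subrK [d * c]mulrC.
by apply: spanD; apply: spanM.
Qed.

Lemma span_sum P (I : Type) (r : seq I) (C : pred I) (F : I -> S) :
  (forall i, C i -> span P (F i)) -> span P (\sum_(i <- r | C i) F i).
Proof. by move=> H; apply: (big_ind (span P)) => //; [exact: span0|exact: spanD]. Qed.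

Lemma span_sub P Q f : (forall g, P g -> span Q g) -> span P f -> span Q f.
Proof.
move=> PQ; elim=> [|c h f' Ph _ IH]; first exact: span0.
by apply: spanD => //; apply: spanM; apply: PQ.
Qed.

Lemma spanZK P c f : c != 0 -> span P (c *: f) -> span P f.
Proof. by move=> c0 /(spanZ c^-1); rewrite scalerA mulVf // scale1r. Qed.

Definition below (J : S -> Prop) e g := J g /\ exists2 d, (d < e)%N & g \is d.-homog.

Definition decomposable J e := span (below J e).

End Span.

Lemma span_rmorph (k : fieldType) (N M : nat)
    (phi : {rmorphism {mpoly k[N]} -> {mpoly k[M]}})
    (P : {mpoly k[N]} -> Prop) (Q : {mpoly k[M]} -> Prop) f :
  (forall g, P g -> Q (phi g)) -> span P f -> span Q (phi f).
Proof.
move=> PQ; elim=> [|c h f' Ph _ IH]; first by rewrite rmorph0; exact: span0.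
by rewrite rmorphD rmorphM; apply: span_cons => //; apply: PQ.
Qed.

Lemma decomposable_rmorph (k : fieldType) (N M : nat)
    (phi : {rmorphism {mpoly k[N]} -> {mpoly k[M]}})
    (J : {mpoly k[N]} -> Prop) (J' : {mpoly k[M]} -> Prop) e f :
  (forall g, J g -> J' (phi g)) ->
  (forall d g, g \is d.-homog -> phi g \is d.-homog) ->
  decomposable J e f -> decomposable J' e (phi f).
Proof.
move=> hJ hphi; apply: span_rmorph => g [Jg [d lt_d hg]].
by split; [apply: hJ|exists d => //; apply: hphi].
Qed.

(** * Adding a column: the highest weight argument *)

Section AddColumn.
Variables (k : fieldType) (A B : finType) (t n : nat) (rows : B -> 'I_t -> A).
Hypothesis char0 : [pchar k] =i pred0.
Hypotheses (t_gt0 : (0 < t)%N) (lt_n : (#|A| + t < n)%N).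
Notation idx := (B * {ffun 'I_t -> 'I_n})%type.
Notation S := {mpoly k[#|{: idx}|]}.
Notation ypol := (@ypol k B t n).
Implicit Types (f g : S).

Definition yrel f := yeval rows f = 0.
Notation K := yrel.
Variable e : nat.
Hypothesis e_gt0 : (0 < e)%N.
Notation dec := (decomposable K e).

Lemma dhomog_var d u : (d == 1)%N -> (var k u : S) \is d.-homog.
Proof. by move/eqP->; rewrite dhomogX; apply/eqP/mdeg1. Qed.

Lemma dhomog_ypol i j d f : f \is d.-homog -> ypol i j f \is d.-homog.
Proof.
by apply: dhomog_der => u; apply: rpred_sum => l _; apply: dhomog_var.
Qed.

Lemma yrel_ypol i j f : K f -> K (ypol i j f).
Proof. by rewrite /K yeval_ypol => ->; rewrite raddf0. Qed.

Lemma decomposable_ypol i j f : dec f -> dec (ypol i j f).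
Proof.
elim=> [|c g f' [Kg [d lt_d hg]] hf' IH]; first by rewrite raddf0; exact: span0.
rewrite raddfD /= ypolM; do 2!apply: spanD => //.
  by apply/spanM/span_gen; split=> //; exists d.
apply/spanM/span_gen; split; first exact: yrel_ypol.
by exists d => //; apply: dhomog_ypol.
Qed.

Definition homrel f := K f /\ f \is e.-homog.

Lemma homrel_ypol i j f : homrel f -> homrel (ypol i j f).
Proof. by case=> Kf hf; split; [apply: yrel_ypol|apply: dhomog_ypol]. Qed.

Lemma homrel_nord L i f : homrel f -> homrel (nord ypol L i f).
Proof.
apply: nord_closed; first by split; [exact: raddf0|exact: dhomog0].
  move=> g g' [Kg hg] [Kg' hg']; split; last by rewrite rpredB.
  by rewrite /K raddfB /= Kg Kg' subr0.
by move=> p q g; apply: homrel_ypol.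
Qed.

(** By Euler's formula [e *: C f] is the sum of the products of the variables
    with the partial derivatives of [C f], which are relations of degree
    [e - 1] by [capelli_deriv]. *)
Lemma decomposable_capelli f : f \is e.-homog -> dec (capelli f).
Proof.
move=> hf; have hC : capelli f \is e.-homog.
  apply: rpred_sum => s _; apply: rpredZ.
  apply: (nord_closed (P := fun g => g \is e.-homog)) hf => [|g g'|p q g].
  - exact: dhomog0.
  - exact: rpredB.
  - exact: dhomog_ypol.
apply: (spanZK (natr_neq0 char0 e_gt0)); rewrite -(euler hC).
apply: span_sum => u _; apply/spanM/span_gen; split.
  exact: capelli_deriv.
exists e.-1; first by rewrite ltn_predL.
exact: dhomog_mderiv.
Qed.

(** Any strictly decreasing function of the column serves as height: [E_ij]
    with [i < j] then raises the weight. *)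
Definition colw (j : 'I_n) : nat := n - j.
Definition idxw (u : idx) : nat := \sum_l colw (u.2 l).

Lemma wt_shift_ypol i j a b f : wt_shift idxw a b f ->
  wt_shift idxw (a + colw i) (b + colw j) (ypol i j f).
Proof.
apply: wt_shift_der => u; apply: wt_shift_sum => l /eqP ul m.
rewrite msuppX mem_seq1 => /eqP ->; rewrite wt_mnm1 /idxw /=.
rewrite (bigD1 l) //= [in RHS](bigD1 l) //= ffunE /upd eqxx ul.
rewrite (eq_bigr (fun x => colw (u.2 x))); last by move=> x /negbTE nx; rewrite ffunE nx.
by rewrite -addnA addnC; congr (_ + _)%N; exact: addnC.
Qed.

Lemma wt_shift_nord (L : seq 'I_n) (i : 'I_n -> 'I_n) a b f :
  uniq L -> wt_shift idxw a b f ->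
  wt_shift idxw (a + \sum_(q <- L) colw (i q)) (b + \sum_(q <- L) colw q)
    (nord ypol L i f).
Proof.
elim: L i => [|j L IH] i /=; first by rewrite !big_nil !addn0.
case/andP=> jL uL hf; rewrite !big_cons; apply: wt_shiftB.
  apply: (wt_shift_eq _ (wt_shift_ypol (IH i uL hf))).
  have ac x X y Y : (a + X + x + (b + (y + Y)) = a + (x + X) + (b + Y + y))%N by lia.
  exact: ac.
rewrite [X in wt_shift _ _ _ X]big_seq_cond; apply: wt_shift_sum => q /andP [qL /eqP iq].
apply: (wt_shift_eq _ (IH (upd i q (i j)) uL hf)).
rewrite (bigD1_seq q) //= [in RHS](bigD1_seq q qL uL) /= {1}/upd eqxx iq.
rewrite (eq_bigr (fun x => colw (i x))); last by move=> x /negbTE nx; rewrite /upd nx.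
lia.
Qed.

Lemma enum_ord_split pre j L q : enum 'I_n = pre ++ j :: L -> q \in L -> (j < q)%N.
Proof.
move=> E qL.
have := iota_ltn_sorted 0 n; rewrite -val_enum_ord sorted_map.
rewrite E sorted_pairwise; last by move=> a b c; apply: ltn_trans.
rewrite pairwise_cat /= => /and3P [_ _ /andP [/allP H _]].
exact: H.
Qed.

Section HighestWeight.
Variables (s : nat) (f : S) (lam : 'I_n -> nat).
Hypothesis higher : forall g, homrel g ->
  (forall m, m \in msupp g -> (s < wt idxw m)%N) -> dec g.
Hypotheses (fK : homrel f) (f_wt : wt_shift idxw s 0 f).
Hypothesis f_eigen : forall p, ypol p p f = (lam p)%:R *: f.

(** Take a permutation [sg] that fixes the columns of [pre], and let [L] be the
    remaining columns. Modulo decomposable relations the partial normally ordered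
    product acts on [f] as [sgn sg] times a natural number. Let [j] be the first
    column of [L].
    If [sg j = j], then [E_jj] multiplies by the multidegree [lam j].
    Otherwise the factors after the first raise the weight, because their
    targets [sg q] are the columns of [L], except that [j] replaces [sg j > j];
    what they produce is decomposable by assumption and only the contraction of
    [E_(sg j, j)] remains. It is the product for [sg] followed by the
    transposition of [j] and [sg j], which fixes [j], and both the contraction
    and the transposition contribute a sign. *)
Lemma nord_lead L pre (sg : 'S_n) : enum 'I_n = pre ++ L ->
  {in pre, forall q, sg q = q} ->
  exists2 c : nat, dec (nord ypol L sg f - ((-1) ^+ sg * c%:R) *: f)
    & sg = 1%g -> (forall p, (0 < lam p)%N) -> (0 < c)%N.
Proof.
elim: L pre sg => [|j L IH] pre sg E fix_pre.
  exists 1%N => //=; suff -> : sg = 1%g.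
    by rewrite odd_perm1 expr0 mul1r scale1r subrr; exact: span0.
  apply/permP => q; rewrite perm1 fix_pre //.
  by rewrite -[pre]cats0 -E mem_enum.
have E' : enum 'I_n = rcons pre j ++ L by rewrite cat_rcons.
have uE : uniq (pre ++ j :: L) by rewrite -E enum_uniq.
have [jpre jL uL] : [/\ j \notin pre, j \notin L & uniq L].
  move: uE; rewrite cat_uniq /= => /and3P [_ /norP [? _] /andP [? ?]].
  by [].
have inL q : q \in pre ++ j :: L by rewrite -E mem_enum.
have [sj|neq] := eqVneq (sg j) j.
  have fix' : {in rcons pre j, forall q, sg q = q}.
    by move=> q; rewrite mem_rcons inE => /predU1P [->|/fix_pre].
  have [c hc c_gt0] := IH _ _ E' fix'.
  exists (c * lam j)%N; last by move=> s1 l0; rewrite muln_gt0 c_gt0 ?l0.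
  rewrite /= big_seq_cond big_pred0 ?subr0 ?sj; last first.
    move=> q; case qL: (q \in L) => //=; apply/eqP => sq.
    by move: sq; rewrite -{1}sj => /perm_inj qj; rewrite -qj qL in jL.
  have := decomposable_ypol j j hc; rewrite raddfB /= linearZ /= f_eigen scalerA.
  by rewrite natrM mulrA.
have sjL : sg j \in L.
  have := inL (sg j); rewrite mem_cat inE (negbTE neq) /= => /orP [sjp|//].
  by have /perm_inj := fix_pre _ sjp => sjj; rewrite sjj eqxx in neq.
have lt_j := enum_ord_split E sjL.
pose tau := (sg * tperm j (sg j))%g.
have fix_tau : {in rcons pre j, forall q, tau q = q}.
  move=> q; rewrite mem_rcons inE permM => /predU1P [->|qp]; first by rewrite tpermR.
  rewrite (fix_pre q qp) tpermD //; apply: contraNneq jpre => jq; first by rewrite jq.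
  by move: (qp); rewrite -jq => sjp; have /perm_inj sjj := fix_pre _ sjp; rewrite -{1}sjj.
have [c hc _] := IH _ _ E' fix_tau.
exists c; last by move=> s1; rewrite s1 perm1 eqxx in neq.
(* the only factor that [E_(sg j, j)] can be contracted with *)
pose q0 := (sg^-1)%g j.
have sq0 : sg q0 = j by rewrite permKV.
have q0j : q0 != j by apply: contraNneq neq => q0j; rewrite -{1}q0j sq0.
have q0L : q0 \in L.
  have := inL q0; rewrite mem_cat inE (negbTE q0j) /= => /orP [q0p|//].
  by move: (fix_pre _ q0p); rewrite sq0 => ejq; rewrite ejq eqxx in q0j.
have -> : nord ypol (j :: L) sg f = ypol (sg j) j (nord ypol L sg f) - nord ypol L tau f.
  rewrite /= (big_rem q0) //= sq0 eqxx big1_seq ?addr0.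
    congr (_ - _); apply: eq_nord => q qL; rewrite /upd permM.
    case: eqP => [->|/eqP nq]; first by rewrite sq0 tpermL.
    rewrite tpermD //.
      by apply: contraNneq nq => jq; apply/eqP/(@perm_inj _ sg); rewrite sq0.
    by apply: contraNneq jL => /perm_inj ->.
  move=> q /andP [/eqP sq]; rewrite mem_rem_uniq // inE => /andP [nq _].
  by move: nq; rewrite (_ : q = q0) ?eqxx //; apply: (@perm_inj _ sg); rewrite sq sq0.
have -> : (-1) ^+ sg = - (-1) ^+ tau :> k.
  rewrite odd_permM odd_tperm eq_sym neq addbT.
  by case: (odd_perm sg); rewrite ?expr0 ?expr1 ?opprK.
rewrite mulNr scaleNr opprK.
rewrite -addrA [X in _ + X]addrC -opprB; apply: spanB; last exact: hc.
apply/decomposable_ypol/higher; first exact: homrel_nord.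
move=> m /(wt_shift_nord uL f_wt); rewrite add0n => H.
have W : (\sum_(q <- enum 'I_n) colw (sg q) = \sum_(q <- enum 'I_n) colw q)%N.
  by rewrite !big_enum [RHS](reindex_inj (@perm_inj _ sg)).
move: W; rewrite E !big_cat !big_cons /= (eq_big_seq colw); last by move=> q /fix_pre ->.
have lt_w : (colw (sg j) < colw j)%N by rewrite /colw; have := ltn_ord (sg j); lia.
have cancel a b X Y x y : (x + X = y + Y -> a + Y = b + X -> x < y -> b < a)%N by lia.
move=> /addnI W; exact: (cancel _ _ _ _ _ _ W H lt_w).
Qed.

(** All signs in the Capelli element cancel against those of [nord_lead], so
    [C f] is [f] times a sum of naturals, to which the identity permutation
    contributes a positive one. *)
Lemma highest_weight_step : (forall p, (0 < lam p)%N) -> dec f.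
Proof.
move=> lam_gt0.
have /fin_all_exists2 [c hc c_gt0] := fun sg : 'S_n => @nord_lead (enum 'I_n) [::] sg erefl
  (fun q (qn : q \in [::]) => False_ind _ (notF qn)).
have C0 : (0 < \sum_(sg : 'S_n) c sg)%N.
  by rewrite (bigD1 1%g) //= ltn_addr // c_gt0.
apply: (spanZK (natr_neq0 char0 C0)).
have -> : (\sum_(sg : 'S_n) c sg)%:R *: f = capelli f -
   \sum_(sg : 'S_n) (-1) ^+ sg *:
     (nord ypol (enum 'I_n) sg f - ((-1) ^+ sg * (c sg)%:R) *: f).
  rewrite /capelli -sumrB natr_sum scaler_suml; apply: eq_bigr => sg _.
  by rewrite -scalerBr opprB addrC subrK scalerA signrMK.
apply: spanB; first by apply: decomposable_capelli; case: fK.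
by apply: span_sum => sg _; apply/spanZ/hc.
Qed.
End HighestWeight.

Definition colcount p (u : idx) : nat := \sum_l (u.2 l == p).

Lemma ypol_eigen p d f : f \is d.-homog for (wt (colcount p)) ->
  ypol p p f = d%:R *: f.
Proof.
move=> hf; rewrite -(der_scale_var hf); apply: eq_der => u.
rewrite natr_sum scaler_suml big_mkcond; apply: eq_bigr => l _ /=.
case: eqP => [ul|_]; last by rewrite scale0r.
rewrite scale1r; case: u ul => r c /= ul; rewrite /yvar; congr (var k (r, _)).
by apply/ffunP => x; rewrite ffunE /upd; case: eqP => // ->.
Qed.

Lemma yrel_pihomog p d f : K f -> K (pihomog (wt (colcount p)) d f).
Proof.
pose h (j : 'I_n) : nat := (j == p).
move=> Kf; rewrite /K /yeval.
rewrite (subst_pihomog (mf := wt (fun u : (A + 'I_t) * 'I_n => h u.2))).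
  by rewrite [subst _ f]Kf raddf0.
by move=> u; apply: dhomog_xminor.
Qed.

Lemma idxw_colcount u : idxw u = (\sum_p colw p * colcount p u)%N.
Proof.
under eq_bigr => p _ do rewrite /colcount big_distrr.
rewrite exchange_big; apply: eq_bigr => l _ /=.
rewrite (bigD1 (u.2 l)) //= eqxx muln1 big1 ?addn0 // => p /negbTE.
by rewrite eq_sym => ->; rewrite muln0.
Qed.

(** The components for one column after the other are taken, so that in the
    end all multidegrees are fixed. *)
Lemma multihomog_ind (P : S -> Prop) (Q : S -> Prop) :
  P 0 -> (forall f g, P f -> P g -> P (f + g)) ->
  (forall p d f, Q f -> Q (pihomog (wt (colcount p)) d f)) ->
  (forall f, Q f -> (forall p, exists d, f \is d.-homog for (wt (colcount p))) -> P f) ->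
  forall f, Q f -> P f.
Proof.
move=> P0 PD Qpi H.
suff G (L : seq 'I_n) f : Q f ->
    (forall p, p \notin L -> exists d, f \is d.-homog for (wt (colcount p))) -> P f.
  by move=> f Qf; apply: (G (enum 'I_n)) => // p; rewrite mem_enum.
elim: L f => [|j L IH] f Qf hf; first by apply: H => // p; apply: hf.
rewrite (@pihomog_partitionE _ _ (wt (colcount j)) _ f (leqnn _)).
apply: (big_ind P) => // d _; apply: IH; first exact: Qpi.
move=> p pL; have [->|neq] := eqVneq p j; first by exists d; apply: pihomogP.
have [|d' hd'] := hf p; first by rewrite inE (negbTE neq).
by exists d'; apply: dhomog_pihomog.
Qed.

Lemma wt_idxw_le m : (wt idxw m <= mdeg m * (t * n))%N.
Proof.
rewrite -wt_const /wt; apply: leq_sum => u _; rewrite leq_mul2l; apply/orP; right.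
rewrite /idxw -[X in (X * _)%N]card_ord -sum_nat_const; apply: leq_sum => l _.
exact: leq_subr.
Qed.

(** Downward induction on the lowest weight [s] that occurs: weights are at most
    [e * (t * n)], and [r] is the distance to this bound. *)
Lemma decomposable_of_missing_column :
  (forall f p, homrel f ->
     (forall m u l, m \in msupp f -> m (enum_rank u) != 0%N -> u.2 l != p) -> dec f) ->
  forall f, homrel f -> dec f.
Proof.
move=> missing f fK.
suff G r : forall s g, (e * (t * n) < s + r)%N -> homrel g ->
    (forall m, m \in msupp g -> (s <= wt idxw m)%N) -> dec g.
  by apply: (G (e * (t * n)).+1 0%N f).
elim: r => [|r IH] s g le_s gK hs.
  have -> : g = 0; last exact: span0.
  apply/eqP; rewrite -msupp_eq0; case E : (msupp g) => [//|m L].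
  have mg : m \in msupp g by rewrite E mem_head.
  have := hs m mg; have := wt_idxw_le m; have /= -> := dhomog_mf (proj2 gK) mg; lia.
pose Q g := homrel g /\ forall m, m \in msupp g -> (s <= wt idxw m)%N.
apply: (@multihomog_ind (fun g => dec g) Q); last by split.
- exact: span0.
- exact: spanD.
- move=> p d h [[Kh hh] hsh]; split; last by move=> m /msupp_pihomog /hsh.
  by split; [exact: yrel_pihomog|exact: dhomog_pihomog].
move=> {g gK hs} g [gK hs] /fin_all_exists [lam hlam].
have wtE m : m \in msupp g -> wt idxw m = (\sum_p colw p * lam p)%N.
  move=> mg; rewrite (eq_wt idxw_colcount) wt_sum; apply: eq_bigr => p _.
  by rewrite wtZ; congr (_ * _)%N; apply: (dhomog_mf (hlam p)).
have [lt_s|ge_s] := ltnP s (\sum_p colw p * lam p)%N.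
  by apply: (IH s.+1) => // [|m mg]; [lia|rewrite wtE].
have g_wt : wt_shift idxw s 0 g.
  by move=> m mg; apply/eqP; rewrite addn0 eqn_leq (hs m mg) wtE // ge_s.
have [/forallP lam_gt0|] := boolP [forall p, (0 < lam p)%N].
  apply: (highest_weight_step (s := s) _ gK g_wt _ lam_gt0).
    by move=> h hK hsh; apply: (IH s.+1) => //; lia.
  by move=> p; apply: ypol_eigen.
case/forallPn => p; rewrite -eqn0Ngt => /eqP lam0.
apply: (missing g p gK) => m u l mg mu; apply/eqP => ul.
have := dhomog_mf (hlam p) mg; rewrite lam0 /= /wt (bigD1 u) //= => /eqP.
rewrite addn_eq0 muln_eq0 (negbTE mu) /= /colcount (bigD1 l) //= ul eqxx.
by rewrite addSn.
Qed.

End AddColumn.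

(** * Changing the number of columns *)

Section ColumnMaps.
Variables (k : fieldType) (A B : finType) (t : nat) (rows : B -> 'I_t -> A).
Notation idx n := (B * {ffun 'I_t -> 'I_n})%type.
Notation S n := {mpoly k[#|{: idx n}|]}.
Notation R n := {mpoly k[#|{: (A + 'I_t) * 'I_n}|]}.

Definition colmap n n' (phi : 'I_n -> 'I_n') : S n -> S n' :=
  subst (fun u : idx n => yvar k u.1 (phi \o u.2)).
HB.instance Definition _ n n' phi := GRing.RMorphism.on (@colmap n n' phi).
HB.instance Definition _ n n' phi := GRing.Linear.on (@colmap n n' phi).

Definition xcolmap n n' (phi : 'I_n -> 'I_n') : R n -> R n' :=
  subst (fun u : (A + 'I_t) * 'I_n => xvar k u.1 (phi u.2)).
HB.instance Definition _ n n' phi := GRing.RMorphism.on (@xcolmap n n' phi).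

Lemma yeval_colmap n n' (phi : 'I_n -> 'I_n') f :
  yeval rows (colmap phi f) = xcolmap phi (yeval rows f).
Proof.
rewrite /colmap /xcolmap /yeval !subst_comp; apply: eq_subst => u.
rewrite [LHS]yeval_yvar -/(xcolmap phi) /xminor -det_map_mx; congr (\det _).
by apply/matrixP => a b; rewrite !mxE [RHS]subst_var.
Qed.

Lemma homrel_colmap n n' (phi : 'I_n -> 'I_n') e f :
  homrel rows e f -> homrel rows e (colmap phi f).
Proof.
case=> Kf hf; split; last first.
  by apply: dhomog_subst => // u; rewrite dhomogX; apply/eqP/mdeg1.
by rewrite /yrel yeval_colmap Kf raddf0.
Qed.

Lemma decomposable_colmap n n' (phi : 'I_n -> 'I_n') e f :
  decomposable (@yrel k A B t n rows) e f ->
  decomposable (@yrel k A B t n' rows) e (colmap phi f).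
Proof.
apply: (span_rmorph (phi := colmap phi)) => g [Kg [d lt_d hg]].
have [Kg' hg'] := @homrel_colmap n n' phi d g (conj Kg hg).
by split=> //; exists d.
Qed.

Lemma colmapK n n' (phi : 'I_n -> 'I_n') (psi : 'I_n' -> 'I_n) (f : S n) :
  (forall m u l, m \in msupp f -> m (enum_rank u) != 0%N ->
     psi (phi (u.2 l)) = u.2 l) ->
  colmap psi (colmap phi f) = f.
Proof.
move=> H; rewrite /colmap subst_comp; apply: subst_id_supp => m u mf mu.
rewrite subst_var /yvar /=; case: u mu => r c mu /=; congr (var k (r, _)).
by apply/ffunP => l; rewrite !ffunE /= ?ffunE (H m (r, c)).
Qed.

Definition all_decomposable n e :=
  forall f : S n, homrel rows e f -> decomposable (@yrel k A B t n rows) e f.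

Lemma all_decomposable_narrow n n' e : (0 < n)%N -> (n <= n')%N ->
  all_decomposable n' e -> all_decomposable n e.
Proof.
case: n => // n _ le_n H f fK.
pose psi (j : 'I_n') : 'I_n.+1 := inord j.
rewrite -(@colmapK _ _ (widen_ord le_n) psi f) => [|m u l _ _].
  by apply: decomposable_colmap; apply: H; apply: homrel_colmap.
by rewrite /psi /= inord_val.
Qed.

(** A relation in which column [p] does not occur is the image, under an
    injection of the columns, of a relation for [n] columns. *)
Lemma all_decomposable_widen n e : [pchar k] =i pred0 -> (0 < t)%N -> (0 < e)%N ->
  (#|A| + t <= n)%N -> all_decomposable n e -> all_decomposable n.+1 e.
Proof.
move=> char0 t_gt0 e_gt0 le_n H f fK.
have n_gt0 : (0 < n)%N by lia.
apply: decomposable_of_missing_column => // g p gK miss.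
pose psi (j : 'I_n.+1) : 'I_n := odflt (Ordinal n_gt0) (unlift p j).
rewrite -(@colmapK _ _ psi (lift p) g) => [|m u l mg mu].
  by apply: decomposable_colmap; apply: H; apply: homrel_colmap.
rewrite /psi; case: unliftP => //= ul.
by have := miss m u l mg mu; rewrite ul eqxx.
Qed.

Lemma all_decomposable_all n e : [pchar k] =i pred0 -> (0 < t)%N -> (0 < e)%N ->
  (0 < n)%N -> all_decomposable (#|A| + t) e -> all_decomposable n e.
Proof.
move=> char0 t_gt0 e_gt0 n_gt0 H.
have [le_n|/ltnW le_n] := leqP n (#|A| + t); first exact: all_decomposable_narrow le_n H.
rewrite -(subnKC le_n); elim: (n - _)%N => [|d IH]; first by rewrite addn0.
by rewrite addnS; apply: all_decomposable_widen => //; apply: leq_addr.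
Qed.
End ColumnMaps.

(** * Sorted and unsorted minors *)

Section IncreasingChoices.
Variables (t n : nat).

Lemma incr_lt (f : incr t n) (a b : 'I_t) : (a < b)%N -> (val f a < val f b)%N.
Proof. by case: f => f /= /forallP /(_ a) /forallP /(_ b) /implyP; apply. Qed.

Lemma incr_inj (f : incr t n) : injective (val f).
Proof.
move=> a b E; apply/val_inj; case: (ltngtP a b) => //= /(incr_lt f);
  by rewrite E ltnn.
Qed.

(** Listed increasingly, the values of [f] and [g] are two sorted sequences of
    the same length, one contained in the other. *)
Lemma incr_eq (f g : incr t n) : (forall a, exists b, val f a = val g b) -> f = g.
Proof.
move=> H; pose s (h : incr t n) := [seq val (val h a) | a <- enum 'I_t].
have srt h : sorted ltn (s h).
  rewrite sorted_map; have := iota_ltn_sorted 0 t; rewrite -val_enum_ord sorted_map.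
  by apply: sub_sorted => a b /= /(incr_lt h).
have sub : {subset s f <= s g}.
  move=> x /mapP [a _ ->]; have [b ->] := H a.
  by apply/mapP; exists b; rewrite // mem_enum.
have [_ eqs] := uniq_min_size (sorted_uniq ltn_trans ltnn (srt f)) sub
   (eq_leq (etrans (size_map _ _) (esym (size_map _ _)))).
have E := irr_sorted_eq ltn_trans ltnn (srt f) (srt g) eqs.
apply/val_inj/ffunP => a; apply/val_inj.
by move/eq_in_map: E => /(_ a (mem_enum _ a)).
Qed.

Lemma injective_sortable (c : {ffun 'I_t -> 'I_n}) : injective c ->
  exists2 s : 'S_t, is_incr [ffun l => c (s l)] & True.
Proof.
move=> cI; pose T := [tuple val (c l) | l < t].
have szT : size (sort leq T) == t by rewrite size_sort size_tuple.
have /tuple_permP [s E] : perm_eq (Tuple szT) T by rewrite /= perm_sort.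
exists s => //; apply/forallP => a; apply/forallP => b; apply/implyP => lt_ab.
rewrite !ffunE.
have nE (l : 'I_t) : nth 0%N (sort leq T) l = c (s l).
  have -> : sort leq T = [tuple tnth T (s i) | i < t] by [].
  by rewrite -tnth_nth !tnth_mktuple.
rewrite -!nE ltn_neqAle; apply/andP; split.
  rewrite !nE; apply: contraTneq lt_ab => /val_inj /cI /perm_inj ->.
  by rewrite ltnn.
apply: (sorted_leq_nth leq_trans leqnn); rewrite ?inE ?(eqP szT) //.
  exact: sort_sorted leq_total _.
exact: ltnW.
Qed.
End IncreasingChoices.

Section Transfer.
Variables (k : fieldType) (t m n : nat).
Notation idx := (incr t m * {ffun 'I_t -> 'I_n})%type.
Notation S := {mpoly k[#|{: idx}|]}.
Notation R := {mpoly k[#|{: ('I_m + 'I_t) * 'I_n}|]}.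
Notation T := (minor_ring k t m n).
Notation minor_map := (@minor_map k t m n).
Notation J := (fun p : T => p \in minor_relations k t m n).

Definition incr_rows (r : incr t m) : 'I_t -> 'I_m := val r.
Notation yeval := (@yeval k _ _ t n incr_rows).
Notation K := (@yrel k _ _ t n incr_rows).

HB.instance Definition _ := GRing.RMorphism.copy minor_map
  (@subst k (minor_idx t m n) _ (@generic_minor k t m n)).
HB.instance Definition _ := GRing.Linear.copy minor_map
  (@subst k (minor_idx t m n) _ (@generic_minor k t m n)).

Definition unsort : T -> S := subst (fun u : minor_idx t m n => yvar k u.1 (val u.2)).
HB.instance Definition _ := GRing.RMorphism.on unsort.

Definition entries : 'M[R]_(m, n) := \matrix_(i, j) xvar k (inl i) j.
(** [embed] and [restrict] compare the polynomial ring in the entries of the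
    generic matrix with the one that has [t] additional rows. *)
Definition embed (p : {mpoly k[m * n]}) : R :=
  p \mPo [tuple mxvec entries 0 i | i < m * n].
HB.instance Definition _ := GRing.RMorphism.copy embed
  (comp_mpoly [tuple mxvec entries 0 i | i < m * n]).

Definition restrict : R -> {mpoly k[m * n]} :=
  subst (fun u : ('I_m + 'I_t) * 'I_n =>
    if u.1 is inl i then 'X_(mxvec_index i u.2) else 0).
HB.instance Definition _ := GRing.RMorphism.on restrict.

Definition gen_minor (r : 'I_t -> 'I_m) (c : 'I_t -> 'I_n) : {mpoly k[m * n]} :=
  \det (mxsub r c (generic_mx k m n)).

Lemma embed_gen_minor r c : embed (gen_minor r c) = xminor k (fun a => inl (r a)) c.
Proof.
rewrite /gen_minor -det_map_mx; congr (\det _); apply/matrixP => a b; rewrite !mxE.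
by rewrite [LHS]comp_mpolyXU -tnth_nth tnth_mktuple mxvecE mxE.
Qed.

Lemma restrict_xminor r c : restrict (xminor k (fun a => inl (r a)) c) = gen_minor r c.
Proof.
rewrite /xminor -det_map_mx; congr (\det _); apply/matrixP => a b; rewrite !mxE.
by rewrite [LHS]subst_var.
Qed.

Lemma minor_map_var u : minor_map (var k u) = gen_minor (val u.1) (val u.2).
Proof. exact: subst_var. Qed.

Lemma yeval_unsort q : yeval (unsort q) = embed (minor_map q).
Proof.
apply: (@mpoly_alg_ind _ _ (fun q : T => yeval (unsort q) = embed (minor_map q)))
  => [c|i|g g' E E'|g g' E E'].
- by rewrite [unsort _]substC [yeval _]substC [minor_map _]substC [RHS]comp_mpolyC.
- rewrite -var_enum_val minor_map_var embed_gen_minor [unsort _]subst_var.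
  by rewrite yeval_yvar.
- by rewrite !rmorphD /= E E'.
- by rewrite !rmorphM /= E E'.
Qed.

Lemma minor_map_unsort q : minor_map q = restrict (yeval (unsort q)).
Proof.
apply: (@mpoly_alg_ind _ _ (fun q : T => minor_map q = restrict (yeval (unsort q))))
  => [c|i|g g' E E'|g g' E E'].
- by rewrite [unsort _]substC [yeval _]substC [minor_map _]substC [RHS]substC.
- rewrite -var_enum_val minor_map_var [unsort _]subst_var.
  by rewrite yeval_yvar restrict_xminor.
- by rewrite !rmorphD /= E E'.
- by rewrite !rmorphM /= E E'.
Qed.

Lemma gen_minor_perm r (c : {ffun 'I_t -> 'I_n}) (s : 'S_t) :
  gen_minor r [ffun l => c (s l)] = (-1) ^+ s *: gen_minor r c.
Proof.
have -> : gen_minor r [ffun l => c (s l)] =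
    \det (col_perm s (mxsub r c (generic_mx k m n))).
  by congr (\det _); apply/matrixP => a b; rewrite !mxE ffunE.
by rewrite col_permE det_mulmx det_perm odd_permV mulrC sgn_scale.
Qed.

(** A formal minor with arbitrary columns is, up to a linear relation, 0 when a
    column is repeated and otherwise a signed sorted one. *)
Lemma sorted_lift (u : idx) : exists q : T, [/\ q \is 1.-homog,
  minor_map q = gen_minor (val u.1) u.2 &
  forall c : incr t n, val c = u.2 -> q = var k (u.1, c)].
Proof.
case: u => r c /=.
have var1 c' : (var k (r, c') : T) \is 1.-homog by rewrite dhomogX; apply/eqP/mdeg1.
have [incr_c|nincr] := boolP (is_incr c).
  exists (var k (r, exist _ c incr_c : incr t n)); split=> // [|c' Ec'].
    by rewrite minor_map_var.
  by congr (var k (r, _)); apply/val_inj.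
have nc (c' : incr t n) : val c' = c -> False.
  by move=> E; case/negP: nincr; rewrite -E (valP c').
have [/injectiveP cI|/injectivePn [a [b ab cab]]] := boolP (injectiveb c); last first.
  exists 0; split=> [||c' /nc //]; first exact: dhomog0.
  rewrite raddf0 /gen_minor -det_tr; apply/esym/(determinant_alternate ab) => l.
  by rewrite !mxE cab.
have [s incr_s _] := injective_sortable cI.
exists ((-1) ^+ s *: var k (r, exist _ [ffun l => c (s l)] incr_s : incr t n)).
split=> [||c' /nc //].
  exact: rpredZ.
by rewrite linearZ /= minor_map_var gen_minor_perm scalerA -signr_addb addbb expr0 scale1r.
Qed.

Lemma dhomog_unsort d q : q \is d.-homog -> unsort q \is d.-homog.
Proof. by apply: dhomog_subst => u; rewrite dhomogX; apply/eqP/mdeg1. Qed.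

Lemma unsort_relation q : (q \in minor_relations k t m n) <-> K (unsort q).
Proof.
split; first by rewrite inE => /eqP Jq; rewrite /yrel yeval_unsort Jq rmorph0.
by move=> Kq; rewrite inE minor_map_unsort Kq rmorph0.
Qed.

(** [unsort] embeds the sorted variables into all variables and [rho] sorts
    columns back. Both preserve relations and degrees, [rho] is a retraction, and
    [unsort \o rho] is the identity modulo linear relations; the latter are
    admitted among the forms of degree below [e] because [1 < e]. *)
Lemma relations_decomposable e : (1 < e)%N ->
  (forall q, q \in minor_relations k t m n -> q \is e.-homog -> decomposable J e q) <->
  all_decomposable k incr_rows n e.
Proof.
move=> e_gt1; have [q hq] := fin_all_exists sorted_lift.
have q1 u : q u \is 1.-homog by case: (hq u).
have qmap u : minor_map (q u) = gen_minor (val u.1) u.2 by case: (hq u).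
have qvar r c : q (r, val c) = var k (r, c) by case: (hq (r, val c)) => _ _; apply.
pose rho : S -> T := subst q.
have rhoM : forall f, minor_map (rho f) = restrict (yeval f).
  apply: mpoly_alg_ind => [c|i|g g' E E'|g g' E E'].
  - by rewrite [rho _]substC [minor_map _]substC [yeval _]substC [RHS]substC.
  - rewrite -var_enum_val [rho _]subst_var qmap -restrict_xminor.
    by congr restrict; rewrite [RHS]subst_var.
  - by rewrite [rho _]rmorphD !rmorphD /= E E'.
  - by rewrite [rho _]rmorphM !rmorphM /= E E'.
have rhoK p : rho (unsort p) = p.
  rewrite /rho /unsort subst_comp; apply: subst_id_supp => mm u _ _.
  rewrite subst_var; case: u => r c /=; rewrite -[RHS]qvar.
  by congr (q (r, _)); apply/ffunP => l; rewrite ffunE.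
have rhoJ f : K f -> rho f \in minor_relations k t m n.
  by move=> Kf; rewrite inE rhoM Kf rmorph0.
have rho_homog d f : f \is d.-homog -> rho f \is d.-homog by apply: dhomog_subst.
have lin f : decomposable K e (f - unsort (rho f)).
  apply: (@span_sub _ _ (fun g => K g /\ g \is 1.-homog)).
    by move=> g [Kg hg]; apply: span_gen; split=> //; exists 1%N.
  apply: (@mpoly_alg_ind _ _ (fun f => span _ (f - unsort (rho f))))
    => [c|i|g g' E E'|g g' E E'].
  - by rewrite [rho _]substC [unsort _]substC subrr; apply: span0.
  - apply: span_gen; rewrite -var_enum_val [rho _]subst_var; split.
      rewrite /yrel rmorphB /= yeval_unsort qmap embed_gen_minor.
      by rewrite [X in X - _]subst_var subrr.
    by rewrite rpredB ?dhomog_unsort // dhomogX; apply/eqP/mdeg1.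
  - have -> : unsort (rho (g + g')) = unsort (rho g) + unsort (rho g').
      by rewrite /rho !rmorphD.
    exact: span_subD E E'.
  have -> : unsort (rho (g * g')) = unsort (rho g) * unsort (rho g').
    by rewrite /rho !rmorphM.
  exact: span_subM E E'.
split=> [H f [Kf hf]|H p Jp hp].
  rewrite -[f](subrK (unsort (rho f))); apply: spanD; first exact: lin.
  have unsortJ g : g \in minor_relations k t m n -> K (unsort g) by move/unsort_relation.
  have dec_rho := H _ (rhoJ _ Kf) (rho_homog _ _ hf).
  exact: (decomposable_rmorph (phi := unsort) unsortJ dhomog_unsort dec_rho).
have unsort_p : homrel incr_rows e (unsort p).
  by split; [apply/unsort_relation|apply: dhomog_unsort].
rewrite -[p]rhoK.
exact: (decomposable_rmorph (phi := subst q) rhoJ rho_homog (H _ unsort_p)).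
Qed.

End Transfer.

(** * Relations of degree at most one *)

Section LowDegree.
Variables (k : fieldType) (t m n : nat).
Notation T := (minor_ring k t m n).

Lemma det_incr (N : nat) (r r' : incr t N) :
  \det (\matrix_(a, l) (val r l == val r' a)%:R : 'M[k]_t) = (r == r')%:R.
Proof.
have [->|neq] := eqVneq r r'.
  rewrite -[RHS](det1 k t); congr (\det _); apply/matrixP => a l.
  by rewrite !mxE (inj_eq (@incr_inj _ _ r')) eq_sym.
have /existsP [a /forallP ha] : [exists a, forall l, val r l != val r' a].
  apply: contraR neq => /existsPn H.
  apply/eqP/esym/incr_eq => a; have /forallPn [l] := H a.
  by rewrite negbK => /eqP <-; exists l.
by rewrite (expand_det_row _ a) big1 // => l _; rewrite mxE (negbTE (ha l)) mul0r.
Qed.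

Lemma meval_delta N (p : {mpoly k[N]}) i : p \is 1.-homog ->
  p.@[fun j => (j == i)%:R] = p@_U_(i).
Proof.
move=> hp; apply: (@mpoly_span_ind _ _ (fun p : {mpoly k[N]} => p.@[_] = p@_U_(i)))
  => [|g g' E E'|c g E|mm mp].
- by rewrite meval0 mcoeff0.
- by rewrite mevalD mcoeffD E E'.
- by rewrite mevalZ mcoeffZ E.
have /eqP/mdeg1P [j /eqP ->] := dhomog_mf hp mp.
by rewrite mevalXU mcoeffXU.
Qed.

(** The minors are linearly independent: at the 0-1 matrix with the entries
    [(r l, c l)] equal to 1, the minor with rows [r] and columns [c] is 1 and all
    others vanish. *)
Lemma linear_relation_eq0 (p : T) :
  p \in minor_relations k t m n -> p \is 1.-homog -> p = 0.
Proof.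
rewrite inE => /eqP Jp hp; apply/mpolyP => mm; rewrite mcoeff0.
have [/mdeg1P [i /eqP ->]|neq] := boolP (mdeg mm == 1%N); last first.
  exact: dhomog_nemf_coeff hp neq.
rewrite -meval_delta //; pose r := (enum_val i).1; pose c := (enum_val i).2.
pose M : 'M[k]_(m, n) := \matrix_(a, b) \sum_l (val r l == a)%:R * (val c l == b)%:R.
transitivity ((minor_map p).@[fun j => mxvec M 0 j]); last by rewrite Jp meval0.
rewrite /minor_map comp_mpoly_meval; apply: meval_eq => j; rewrite tnth_mktuple.
rewrite /generic_minor -det_map_mx.
set r' := (enum_val j).1; set c' := (enum_val j).2.
have -> : map_mx (meval (fun j => mxvec M 0 j))
    (mxsub (val r') (val c') (generic_mx k m n)) =
  (\matrix_(a, l) (val r l == val r' a)%:R) *m (\matrix_(a, l) (val c l == val c' a)%:R)^T.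
  apply/matrixP => a b; rewrite !mxE mevalXU mxvecE mxE; apply: eq_bigr => l _.
  by rewrite !mxE.
rewrite det_mulmx det_tr !det_incr -natrM mulnb eq_sym -(inj_eq enum_val_inj).
by rewrite -xpair_eqE /r /c /r' /c' -!surjective_pairing.
Qed.

Lemma constant_relation_eq0 (p : T) :
  p \in minor_relations k t m n -> p \is 0.-homog -> p = 0.
Proof.
rewrite inE => /eqP Jp hp.
have E : p = (p@_0%MM)%:MP.
  apply/mpolyP => mm; rewrite mcoeffC.
  have [->|neq] := eqVneq mm 0%MM; first by rewrite mulr1.
  by rewrite mulr0; apply: (dhomog_nemf_coeff hp); rewrite /= mdeg_eq0.
move: Jp; rewrite E /minor_map comp_mpolyC => /eqP; rewrite mpolyC_eq0 => /eqP ->.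
by rewrite mpolyC0.
Qed.
End LowDegree.

(** * Noetherianity and degrees of minimal generators *)

Section Dickson.

Lemma nat_seq_min_tail (f : nat -> nat) N :
  exists2 i, (N <= i)%N & forall j, (N <= j)%N -> (f i <= f j)%N.
Proof.
suff G v : forall i, (N <= i)%N -> (f i <= v)%N ->
    exists2 i, (N <= i)%N & forall j, (N <= j)%N -> (f i <= f j)%N.
  exact: (G (f N) N).
elim/ltn_ind: v => v IH i le_i le_v.
have [H|H] := boolp.pselect (forall j, (N <= j)%N -> (f i <= f j)%N); first by exists i.
have /boolp.existsNP [j] := H; move/boolp.not_implyP => [le_j /negP].
rewrite -ltnNge => lt_ji.
by apply: (IH (f j) (leq_trans lt_ji le_v) j).
Qed.

Lemma nondecreasing_subseq (f : nat -> nat) : exists phi : nat -> nat,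
  {homo phi : i j / (i < j)%N} /\ {homo f \o phi : i j / (i <= j)%N}.
Proof.
have [g hg] := boolp.choice (fun N => let: ex_intro2 i Hi Hm := nat_seq_min_tail f N in
   ex_intro (fun i => (N <= i)%N /\ forall j, (N <= j)%N -> (f i <= f j)%N) i (conj Hi Hm)).
pose phi := fix phi k := if k is k'.+1 then g (phi k').+1 else g 0%N.
exists phi; have step k : (phi k < phi k.+1)%N by have [] := hg (phi k).+1.
split; first exact: homo_ltn ltn_trans step.
apply: (homo_leq (leqnn) leq_trans) => k /=.
case: k => [|k] /=; first by have [_] := hg 0%N; apply.
have [_ H] := hg (phi k).+1; apply: H.
exact: ltnW (leq_ltn_trans (step k) (step k.+1)).
Qed.

(** Passing to a subsequence once for each variable makes all exponents
    nondecreasing. *)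
Lemma dickson N (F : nat -> 'X_{1..N}) : exists i j, (i < j)%N /\ (F i <= F j)%MM.
Proof.
suff [phi [mono_phi H]] : exists phi : nat -> nat, {homo phi : i j / (i < j)%N} /\
    forall c, c \in enum 'I_N -> {homo (fun i => F (phi i) c) : i j / (i <= j)%N}.
  exists (phi 0%N), (phi 1%N); split; first exact: mono_phi.
  by apply/mnm_lepP => c; apply: H; rewrite ?mem_enum.
elim: (enum 'I_N) => [|c L [phi [mono_phi H]]]; first by exists id; split.
have [psi [mono_psi Hc]] := nondecreasing_subseq (fun i => F (phi i) c).
exists (phi \o psi); split; first by move=> i j /mono_psi /mono_phi.
move=> c'; rewrite inE => /predU1P [->|/H Hc' i j le_ij]; first exact: Hc.
by apply: Hc'; apply: (ltnW_homo mono_psi).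
Qed.
End Dickson.

Import Order.TTheory.

Section GradedIdeal.
Variables (k : fieldType) (N : nat) (J : {mpoly k[N]} -> Prop).
Notation S := {mpoly k[N]}.
Implicit Types (f g p : S) (G : seq S).

Definition span_of G : S -> Prop := span (fun g => g \in G).

Record graded_ideal : Prop := GradedIdeal {
  graded0 : J 0;
  gradedD : forall f g, J f -> J g -> J (f + g);
  gradedM : forall c f, J f -> J (c * f);
  graded_pihomog : forall d f, J f -> J (pihomog mdeg d f) }.

Hypothesis gJ : graded_ideal.

Lemma graded_span (P : S -> Prop) p : (forall g, P g -> J g) -> span P p -> J p.
Proof.
move=> PJ; elim=> [|c g f /PJ Jg _ Jf]; first exact: graded0.
by apply: gradedD => //; apply: gradedM.
Qed.

Definition homogeneous_in G := forall g, g \in G -> J g /\ exists d, g \is d.-homog.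

Let least_outside G g := [/\ J g, exists d, g \is d.-homog,
  ~ span_of G g & forall h, J h -> (exists d, h \is d.-homog) -> ~ span_of G h ->
     (mlead g <= mlead h)%O].

Lemma exists_least_outside G : ~ (forall p, J p -> span_of G p) ->
  exists g, least_outside G g.
Proof.
move=> nspan.
pose out g := [/\ J g, exists d, g \is d.-homog & ~ span_of G g].
have [g0 out0] : exists g, out g.
  apply: boolp.contrapT => H; apply: nspan => p Jp.
  rewrite (@pihomog_partitionE _ _ mdeg _ p (leqnn _)); apply: span_sum => d _.
  apply: boolp.contrapT => nd; apply: H; exists (pihomog mdeg d p); split=> //.
    exact: graded_pihomog.
  by exists d; apply: pihomogP.
elim/mleadrect: g0 out0 => g IH outg.
have [H|H] := boolp.pselect (forall h, out h -> (mlead g <= mlead h)%O).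
  by exists g; case: outg => *; split=> // h *; apply: H.
have /boolp.existsNP [h] := H; move/boolp.not_implyP => [outh /negP].
by rewrite -ltNge => /IH; apply.
Qed.

(** Hilbert's basis theorem. If no finite list generated [J], adjoining
    least forms outside the span again and again would give an infinite sequence;
    by Dickson's lemma the leading monomial of some member [f] would divide that of a
    later member [g], and cancelling the leading term of [g] against [f] would
    contradict the choice of [g]. *)
Lemma graded_fingen : exists2 G, homogeneous_in G & forall p, J p -> span_of G p.
Proof.
apply: boolp.contrapT => H.
have next G : exists g, homogeneous_in G -> least_outside G g.
  have [hG|] := boolp.pselect (homogeneous_in G); last by exists 0.
  have [|g] := @exists_least_outside G; last by exists g.
  by move=> spanG; apply: H; exists G.
have [F hF] := boolp.choice next.
pose Gs := fix Gs i := if i is i'.+1 then F (Gs i') :: Gs i' else [::].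
have homG i : homogeneous_in (Gs i).
  elim: i => [//|i IH] g /=; rewrite inE => /predU1P [->|/IH //].
  by have [] := hF _ IH.
have memG i j : (i < j)%N -> F (Gs i) \in Gs j.
  elim: j => // j IH; rewrite ltnS leq_eqVlt => /predU1P [->|/IH lt_ij].
    exact: mem_head.
  by rewrite inE lt_ij orbT.
have [i [j [lt_ij le_m]]] := dickson (fun i => mlead (F (Gs i))).
have [Jf [d hf] outf _] := hF _ (homG i); have [Jg [e hg] outg min_g] := hF _ (homG j).
have {outf} : F (Gs i) != 0 by apply/eqP => f0; apply: outf; rewrite f0; exact: span0.
move: (F (Gs i)) (F (Gs j)) (memG _ _ lt_ij) le_m Jf hf Jg hg outg min_g.
move=> f g fG le_m Jf hf Jg hg outg min_g f0.
have g0 : g != 0 by apply/eqP => g0; apply: outg; rewrite g0; exact: span0.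
pose x := (mlead g - mlead f)%MM; pose c := g@_(mlead g) / f@_(mlead f).
have lead_x : (x + mlead f)%MM = mlead g by apply: submK.
pose h := g + ((- c) *: 'X_[x]) * f.
have Jh : J h by apply: (gradedD gJ) => //; apply: (gradedM gJ).
have hom_h : h \is e.-homog.
  apply: rpredD => //.
  have <- : (mdeg x + d = e)%N.
    rewrite -(dhomog_mf hf (mlead_supp f0)) -(dhomog_mf hg (mlead_supp g0)) /=.
    by rewrite -mdegD lead_x.
  by apply: dhomogM => //; apply: rpredZ; rewrite dhomogX.
have outh : ~ span_of (Gs j) h.
  move=> hspan; apply: outg; rewrite -[g](addrK (((- c) *: 'X_[x]) * f)).
  by apply: spanB => //; apply/spanM/span_gen.
have h0 : h != 0 by apply/eqP => h0; apply: outh; rewrite h0; exact: span0.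
have lead_h : mlead h = mlead g.
  apply: le_anti; rewrite min_g //; last by exists e.
  rewrite andbT (le_trans (mleadD_le _ _)) // leUx lexx /=.
  rewrite (le_trans (mleadM_le _ _)) //.
  by rewrite -lead_x lemc_add2l (le_trans (mleadZ_le _ _)) // mleadXm.
have := mlead_supp h0; rewrite mcoeff_msupp lead_h => /eqP; apply.
rewrite mcoeffD -scalerAl mcoeffZ ['X_[x] * f]mulrC -lead_x mcoeffMX lead_x.
by rewrite mulNr /c divfK ?subrr // mleadc_eq0.
Qed.

Hypothesis char0 : [pchar k] =i pred0.

(** The coefficients of [in_ideal] depend on the generator and not on its
    position, so a generator that is listed several times gets its coefficient
    divided by the multiplicity; this uses characteristic 0. *)
Lemma in_idealE G p : in_ideal G p <-> span_of G p.
Proof.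
split=> [[c ->]|].
  rewrite big_seq; apply: span_sum => g gG; exact/spanM/span_gen.
elim=> [|c g f gG _ [c' ->]].
  by exists (fun=> 0); rewrite big1 // => g _; rewrite mul0r.
exists (fun h => (if h == g then (count_mem g G)%:R^-1 *: c else 0) + c' h).
under [in RHS]eq_bigr => h _ do rewrite mulrDl.
rewrite big_split /=; congr (_ + _).
rewrite (bigID (fun h => h == g)) /= [X in _ + X]big1 ?addr0; last first.
  by move=> h /negbTE ->; rewrite mul0r.
rewrite (eq_bigr (fun=> (count_mem g G)%:R^-1 *: (c * g))); last first.
  by move=> h /eqP ->; rewrite eqxx scalerAl.
rewrite big_const_seq iter_addr_0 -scaler_nat scalerA divff ?scale1r //.
by apply: natr_neq0 => //; rewrite -has_count; apply/hasP; exists g => /=.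
Qed.

(** Redundant generators are discarded one by one. *)
Lemma exists_min_gen_system (J' : {pred S}) : (forall p, p \in J' <-> J p) ->
  exists G, min_gen_system J' G.
Proof.
move=> JJ'; have [G hG spanG] := graded_fingen.
elim: {G}(size G).+1 {-2}G (ltnSn (size G)) hG spanG => // s IH G le_s hG spanG.
have genP G' : homogeneous_in G' -> (generates G' J' <-> forall p, J p -> span_of G' p).
  move=> hG'; split=> [H p /JJ' /H /in_idealE //|H p].
  split; first by move/JJ'/H/in_idealE.
  by move/in_idealE => sp; apply/JJ'; apply: graded_span sp => g /hG' [].
have [H|H] := boolp.pselect (forall g, g \in G -> ~ generates (rem g G) J').
  by exists G; split=> //; [move=> g /hG []|apply/genP].
have /boolp.existsNP [g] := H; move/boolp.not_implyP => [gG /boolp.contrapT gen].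
have hG' : homogeneous_in (rem g G) by move=> h /mem_rem /hG.
apply: (IH (rem g G)) => //; last by apply/genP.
by rewrite size_rem // prednK // -has_predT; apply/hasP; exists g.
Qed.

(** A multiple of a form of degree above [e] has no component of degree [e], so
    such generators drop out when the component is taken. *)
Lemma span_pihomog (P : S -> Prop) e p : (forall g, P g -> exists d, g \is d.-homog) ->
  span P p ->
  span (fun g => P g /\ exists2 d, (d <= e)%N & g \is d.-homog) (pihomog mdeg e p).
Proof.
move=> hP; elim=> [|c g f Pg _ IH]; first by rewrite raddf0; exact: span0.
rewrite raddfD /=; apply: spanD => //; have [d hg] := hP _ Pg.
apply: (@mpoly_span_ind _ _ (fun c => span _ (pihomog mdeg e (c * g))))
  => [|f1 f2 E E'|a f1 E|x _].
- by rewrite mul0r raddf0; exact: span0.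
- by rewrite mulrDl raddfD; apply: spanD.
- by rewrite -scalerAl linearZ; apply: spanZ.
have hX : 'X_[x] * g \is (mdeg x + d).-homog by apply: dhomogM; rewrite ?dhomogX.
have [E|neq] := eqVneq (mdeg x + d)%N e; last first.
  by rewrite (pihomog_ne0 neq hX); exact: span0.
rewrite pihomog_dE; last by rewrite -E.
apply/spanM/span_gen; split=> //.
by exists d; rewrite // -E leq_addl.
Qed.

Variable J' : {pred S}.
Hypothesis JJ' : forall p, p \in J' <-> J p.

(** If a member [g] of a minimal system were a combination of forms of smaller
    degree, these would be combinations of members other than [g], and [g] would
    be redundant. *)
Lemma min_gen_degree_indecomposable e : is_min_gen_degree J' e ->
  exists f, [/\ J f, f \is e.-homog & ~ decomposable J e f].
Proof.
case=> G [g [[homG genG remG] gG hg]].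
have JG h : h \in G -> J h by move=> hG; apply/JJ'/genG/in_idealE/span_gen.
exists g; split=> // [|dec_g]; first exact: JG.
apply: (remG g gG) => p; split; last first.
  by move/in_idealE/(graded_span (fun h hG => JG h (mem_rem hG)))/JJ'.
move/genG/in_idealE => sp; apply/in_idealE.
suff sg : span_of (rem g G) g.
  apply: span_sub sp => h hG; have [->//|neq] := eqVneq h g.
  apply: span_gen; move: hG; rewrite (perm_mem (perm_to_rem gG)) inE.
  by rewrite (negbTE neq).
apply: span_sub dec_g => h [/JJ'/genG/in_idealE sh [d lt_d hh]].
rewrite -[h](pihomog_dE hh).
apply: span_sub (span_pihomog d homG sh) => h' [h'G [d' le_d' hh']].
have [E|neq] := eqVneq h' g; last first.
  apply: span_gen; move: h'G; rewrite (perm_mem (perm_to_rem gG)) inE.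
  by rewrite (negbTE neq).
rewrite E in hh' *; have [->|g0] := eqVneq g 0; first exact: span0.
by move: lt_d; rewrite (dhomog_uniq g0 hg hh') ltnNge le_d'.
Qed.

(** Let [d] be the highest degree in some minimal system [G]. Every form of
    degree above [d] is decomposable through [G], so by
    [min_gen_degree_indecomposable] no minimal system has a degree above [d];
    thus the maximum exists and bounds the degrees in [G]. *)
Lemma decomposable_gt_max e f : (max_gen_degree J' < e)%N -> J f -> f \is e.-homog ->
  decomposable J e f.
Proof.
move=> lt_e Jf hf; have [G minG] := exists_min_gen_system JJ'.
have [homG genG remG] := minG.
have JG g : g \in G -> J g.
  move=> gG; apply/JJ'/genG/in_idealE/span_gen => //.
have spanG p : J p -> span_of G p by move/JJ'/genG/in_idealE.
case: (G =P [::]) => [G0|G_neq].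
  have -> : f = 0; last exact: span0.
  by have := spanG _ Jf; rewrite G0; elim=> // c g h; rewrite inE.
(* the degree of a nonzero form; members of [G] that vanish get degree 0 *)
pose deg g := (msize g).-1.
have hdeg g : g \in G -> g \is (deg g).-homog.
  by move=> gG; have [d hg] := homG g gG; apply: dhomog_msize hg.
have dec_deg d h : (forall g, g \in G -> (deg g < d)%N) -> J h -> decomposable J d h.
  move=> lt_d Jh; apply: span_sub (spanG _ Jh) => g gG; apply: span_gen; split.
    exact: JG.
  by exists (deg g); [apply: lt_d|apply: hdeg].
have ex_deg : exists d, has (fun g => deg g == d) G.
  case: (G) G_neq => // g G' _; exists (deg g); by rewrite /= eqxx.
have bnd d : has (fun g => deg g == d) G -> (d <= \max_(g <- G) deg g)%N.
  by case/hasP => g gG /eqP <-; apply: leq_bigmax_seq.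
case: (ex_maxnP ex_deg bnd) => d /hasP [g gG /eqP deg_g] max_d.
have le_deg h : h \in G -> (deg h <= d)%N.
  by move=> hG; apply: max_d; apply/hasP; exists h.
have max_J : is_max_gen_degree J' (max_gen_degree J').
  apply: classical_sets.xgetPex; exists d; split.
    by exists G, g; split=> //; rewrite -deg_g; apply: hdeg.
  move=> e' /min_gen_degree_indecomposable [h [Jh hh ndec]].
  rewrite leqNgt; apply/negP => lt_d; apply: ndec; apply: dec_deg => // h' /le_deg le_h'.
  exact: leq_ltn_trans lt_d.
apply: dec_deg => // h hG; apply: leq_ltn_trans lt_e; case: max_J => _; apply.
by exists G, h; split=> //; apply: hdeg.
Qed.

Lemma max_gen_degree_le b :
  (forall e, (b < e)%N -> forall f, J f -> f \is e.-homog -> decomposable J e f) ->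
  (max_gen_degree J' <= b)%N.
Proof.
move=> H; rewrite /max_gen_degree; case: classical_sets.xgetP => // e _ [min_e _].
have [f [Jf hf ndec]] := min_gen_degree_indecomposable min_e.
by rewrite leqNgt; apply/negP => lt_b; apply: ndec; apply: H.
Qed.

End GradedIdeal.

(** * The theorem *)

Section RelationIdeal.
Variables (k : fieldType) (t m n : nat).

Lemma dhomog_generic_minor (u : minor_idx t m n) : generic_minor k u \is t.-homog.
Proof.
rewrite /generic_minor; set M := mxsub _ _ _.
apply: rpred_sum => s _; rewrite sgn_scale; apply: rpredZ.
suff : \prod_a M a (s a) \is (\sum_(a < t) 1)%N.-homog by rewrite sum1_card card_ord.
elim/big_rec2: _ => [|a d g _ hg]; first exact: dhomog1.
by apply: dhomogM hg; rewrite !mxE dhomogX; apply/eqP/mdeg1.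
Qed.

Lemma graded_minor_relations : (0 < t)%N ->
  graded_ideal (fun p : minor_ring k t m n => p \in minor_relations k t m n).
Proof.
move=> t_gt0; split=> [|f g|c f|d f]; rewrite !inE.
- by rewrite raddf0.
- by move=> /eqP Jf /eqP Jg; rewrite rmorphD /= Jf Jg addr0.
- by move=> /eqP Jf; rewrite rmorphM /= Jf mulr0.
move=> /eqP Jf.
have -> : pihomog mdeg d f = pihomog (wt (fun _ : minor_idx t m n => t)) (d * t) f.
  rewrite !pihomogE; apply: eq_bigl => mm /=.
  by rewrite wt_const eqn_pmul2r.
rewrite [minor_map _](subst_pihomog _ _ (@dhomog_generic_minor)).
by rewrite [subst _ f]Jf raddf0.
Qed.
End RelationIdeal.

Local Close Scope ring_scope.

Theorem theorem3p2p6 (k : fieldType) (char0 : [pchar k]%R =i pred0)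
    (t m n : nat) (le_mn : m <= n) (gt1_t : 1 < t) (lt_tm : t < m)
    (gt_n : t + 1 < n) :
  max_relation_degree k t m n <= max_relation_degree k t m (m + t).
Proof.
have t_gt0 : (0 < t)%N by exact: ltnW.
pose gJ n' := graded_minor_relations k m n' t_gt0.
apply: (max_gen_degree_le (gJ n)) => // [e gt_e f Jf hf].
case: e gt_e hf => [|[|e]] gt_e hf.
- by rewrite (constant_relation_eq0 Jf hf); exact: span0.
- by rewrite (linear_relation_eq0 Jf hf); exact: span0.
suff /relations_decomposable H : all_decomposable k (@incr_rows t m) n e.+2 by apply: H.
apply: all_decomposable_all => //; first by lia.
rewrite card_ord; apply/relations_decomposable => // p Jp hp.
exact: (decomposable_gt_max (gJ (m + t)%N) char0 _ gt_e).
Qed.
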